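(* (i) Let $(\mathcal A,[\cdot,\cdot],\mu,\alpha)$ be a multiplicative Hom-Poisson superalgebra. Suppose that $\mathfrak B$ is a nondegenerate supersymmetric bilinear form on $\mathcal A$ such that it is a super-commutative $2$-cocycle on $(\mathcal A,[\cdot,\cdot],\alpha)$ and a super-commutative Connes cocycle on $(\mathcal A,\mu,\alpha)$. Then there is a compatible Hom-anti-pre-Poisson superalgebra $(\mathcal A,\circ,\star,\alpha)$, in which $\star$ and $\circ$ are respectively defined by $$\mathfrak B(\alpha(x)\star\alpha(y),\alpha^2(z))=-(-1)^{|x||y|}\mathfrak B(\alpha(y),\mu(x,z)),\qquad \mathfrak B(\alpha(x)\circ\alpha(y),\alpha^2(z))=(-1)^{|x||y|}\mathfrak B(\alpha(y),[x,z])$$ for all homogeneous $x,y,z\in\mathcal A$. (ii) Conversely, let $(\mathcal A,\circ,\star,\alpha)$ be a Hom-anti-pre-Poisson superalgebra and let $(\mathcal A,[\cdot,\cdot],\mu,\alpha)$ be its sub-adjacent Hom-Poisson superalgebra. Then there is a Hom-Poisson superalgebra $\mathcal A\ltimes_{-\mathfrak L_\circ^\star,\mathfrak L_\star^\star}\mathcal A^*$, and the natural nondegenerate supersymmetric bilinear form $\mathfrak B_d$ on $\mathcal A\oplus\mathcal A^*$ is a super-commutative $2$-cocycle on the Hom-Lie superalgebra $\mathcal A\ltimes_{-\mathfrak L_\circ^\star}\mathcal A^*$ and a super-commutative Connes cocycle on the super-commutative Hom-associative superalgebra $\mathcal A\ltimes_{\mathfrak L_\star^\star}\mathcal A^*$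.
   Context: All vector spaces are finite-dimensional over a field $\mathbb K$ of characteristic $0$. Superspaces are $\mathbb Z_2$-graded, $|x|$ is the parity of a homogeneous element $x$, and identities are required for homogeneous elements. All structure maps are even (parity preserving). Hom-Lie superalgebra $(\mathcal A,[\cdot,\cdot],\alpha)$: $[x,y]=-(-1)^{|x||y|}[y,x]$ and $[\alpha(x),[y,z]]=[[x,y],\alpha(z)]+(-1)^{|x||y|}[\alpha(y),[x,z]]$. Super-commutative Hom-associative superalgebra $(\mathcal A,\mu,\alpha)$: $\mu(x,y)=(-1)^{|x||y|}\mu(y,x)$ and $\mu(\mu(x,y),\alpha(z))=\mu(\alpha(x),\mu(y,z))$. Hom-Poisson superalgebra $(\mathcal A,[\cdot,\cdot],\mu,\alpha)$: $(\mathcal A,[\cdot,\cdot],\alpha)$ is a Hom-Lie superalgebra, $(\mathcal A,\mu,\alpha)$ is a super-commutative Hom-associative superalgebra, and $[\alpha(x),\mu(y,z)]=\mu([x,y],\alpha(z))+(-1)^{|x||y|}\mu(\alpha(y),[x,z])$. It is multiplicative if $\alpha$ preserves both $[\cdot,\cdot]$ and $\mu$. Hom-anti-pre-Lie superalgebra $(\mathcal A,\circ,\alpha)$: with $[x,y]_\circ=x\circ y-(-1)^{|x||y|}y\circ x$, $\alpha(x)\circ(y\circ z)-(-1)^{|x||y|}\alpha(y)\circ(x\circ z)=(-1)^{|x||y|}[y,x]_\circ\circ\alpha(z)$ and $[x,y]_\circ\circ\alpha(z)+(-1)^{|x|(|y|+|z|)}[y,z]_\circ\circ\alpha(x)+(-1)^{|z|(|x|+|y|)}[z,x]_\circ\circ\alpha(y)=0$.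 Hom-anti-Zinbiel superalgebra $(\mathcal A,\star,\alpha)$: $\alpha(x)\star(y\star z)=-(x\star y+(-1)^{|x||y|}y\star x)\star\alpha(z)$ and $\alpha(x)\star(y\star z)=(-1)^{|x|(|y|+|z|)}\alpha(y)\star(z\star x)$. Hom-anti-pre-Poisson superalgebra $(\mathcal A,\circ,\star,\alpha)$: $(\mathcal A,\circ,\alpha)$ is a Hom-anti-pre-Lie superalgebra, $(\mathcal A,\star,\alpha)$ is a Hom-anti-Zinbiel superalgebra, and, writing $\{x,y\}_\star=x\star y+(-1)^{|x||y|}y\star x$, (1) $[x,y]_\circ\star\alpha(z)=(-1)^{|x||y|}\alpha(y)\star(x\circ z)-\alpha(x)\circ(y\star z)$; (2) $\{x,y\}_\star\circ\alpha(z)=-\alpha(x)\star(y\circ z)-(-1)^{|x||y|}\alpha(y)\star(x\circ z)$; (3) $(-1)^{|y||z|}\alpha(x)\star(z\circ y)+(-1)^{|x|(|y|+|z|)}\alpha(y)\star(z\circ x)=(-1)^{|z|(|x|+|y|)}\alpha(z)\circ\{x,y\}_\star-\{x,y\}_\star\circ\alpha(z)$. Its sub-adjacent Hom-Poisson superalgebra is $(\mathcal A,[\cdot,\cdot]_\circ,\{\cdot,\cdot\}_\star,\alpha)$. It is compatible with $(\mathcal A,[\cdot,\cdot],\mu,\alpha)$ if $[\cdot,\cdot]_\circ=[\cdot,\cdot]$ and $\{\cdot,\cdot\}_\star=\mu$. A bilinear form is even if $\mathfrak B(\mathcal A_{\bar 0},\mathcal A_{\bar 1})=\mathfrak B(\mathcal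 A_{\bar 1},\mathcal A_{\bar 0})=0$; it is supersymmetric if $\mathfrak B(x,y)=(-1)^{|x||y|}\mathfrak B(y,x)$. A super-commutative $2$-cocycle on a Hom-Lie superalgebra $(\mathcal A,[\cdot,\cdot],\alpha)$ is an even supersymmetric form with $\mathfrak B(\alpha(x),[y,z])+(-1)^{|x|(|y|+|z|)}\mathfrak B(\alpha(y),[z,x])+(-1)^{|z|(|x|+|y|)}\mathfrak B(\alpha(z),[x,y])=0$. A super-commutative Connes cocycle on a super-commutative Hom-associative superalgebra $(\mathcal A,\mu,\alpha)$ is an even supersymmetric form with $\mathfrak B(\mu(x,y),\alpha(z))+(-1)^{|x|(|y|+|z|)}\mathfrak B(\mu(y,z),\alpha(x))+(-1)^{|z|(|x|+|y|)}\mathfrak B(\mu(z,x),\alpha(y))=0$. Dual maps (formed with $\alpha^{-1}$, so $\alpha$ is understood to be invertible where they appear): for $\diamond\in\{\circ,\star\}$ let $\mathfrak L_\diamond(x)v=x\diamond v$ and $\langle\mathfrak L_\diamond^*(x)\xi,v\rangle=-(-1)^{|x||\xi|}\langle\xi,x\diamond v\rangle$ for $\xi\in\mathcal A^*$; then $\mathfrak L_\diamond^\star:\mathcal A\to gl(\mathcal A^* )$ is $\mathfrak L_\diamond^\star(x)\xi=\mathfrak L_\diamond^*(\alpha(x))\big((\alpha^{-2})^*\xi\big)$, where $(\alpha^{-k})^*$ is the transpose of $\alpha^{-k}$. (When $\alpha$ preserves $\diamond$ this reads $\langle\mathfrak L_\diamond^\star(x)\xi,v\rangle=-(-1)^{|x||\xi|}\langle\xi,\alpha^{-1}(x)\diamond\alpha^{-2}(v)\rangle$.)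 The space $\mathcal A\oplus\mathcal A^*$ carries the twisting map $\alpha\oplus(\alpha^{-1})^*$; $\mathcal A\ltimes_{-\mathfrak L_\circ^\star}\mathcal A^*$ has bracket $[x+\xi,y+\zeta]=[x,y]-\mathfrak L_\circ^\star(x)\zeta+(-1)^{|y||\xi|}\mathfrak L_\circ^\star(y)\xi$; $\mathcal A\ltimes_{\mathfrak L_\star^\star}\mathcal A^*$ has product $(x+\xi)\cdot(y+\zeta)=\mu(x,y)+\mathfrak L_\star^\star(x)\zeta+(-1)^{|y||\xi|}\mathfrak L_\star^\star(y)\xi$; $\mathcal A\ltimes_{-\mathfrak L_\circ^\star,\mathfrak L_\star^\star}\mathcal A^*$ has both. The natural form is $\mathfrak B_d(x+\xi,y+\zeta)=\langle x,\zeta\rangle+\langle\xi,y\rangle$, where $\langle\xi,y\rangle=\xi(y)$ and $\langle x,\zeta\rangle=(-1)^{|x||\zeta|}\zeta(x)$.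
   Formalization: In (i) the form is additionally assumed invariant under the twisting map, B(α(x),α(y)) = B(x,y); in (ii) α is additionally assumed to preserve both ∘ and ⋆ (the multiplicative case). The claims fail without such conditions. *)

(* Defs.v *)
From HB Require Import structures.
From mathcomp Require Import all_boot all_order all_algebra.

Set Implicit Arguments.
Unset Strict Implicit.
Unset Printing Implicit Defensive.

Import GRing.Theory.
Local Open Scope ring_scope.

(* Parities are booleans: false is the even parity, true the odd one, and the
   sum of two parities is (+).  ksgn p q is (-1)^{pq}; for instance
   (-1)^{|x|(|y|+|z|)} is ksgn p (q (+) r). *)
Definition ksgn (K : fieldType) (p q : bool) : K := (-1) ^+ (p && q).
Arguments ksgn {K} p q.

Section Superspaces.
Variables (K : fieldType) (V : vectType K) (G : bool -> {vspace V}).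

Definition super_grading :=
  (G false + G true = fullv)%VS /\ (G false :&: G true = 0)%VS.

Definition even_map (f : 'End(V)) := forall p x, x \in G p -> f x \in G p.

Definition even_op (op : V -> V -> V) :=
  forall p q x y, x \in G p -> y \in G q -> op x y \in G (p (+) q).

Definition bilinear_op (op : V -> V -> V) := bilinear_for *:%R *:%R op.

(* p and q stand for the parities of x and y. *)
Definition scomm (op : V -> V -> V) p q x y := op x y - ksgn p q *: op y x.
Definition santi (op : V -> V -> V) p q x y := op x y + ksgn p q *: op y x.

Definition hom_superalgebra (op : V -> V -> V) (alpha : 'End(V)) :=
  [/\ super_grading, bilinear_op op, even_op op & even_map alpha].

Definition hom_Lie (br : V -> V -> V) (alpha : 'End(V)) :=
  [/\ hom_superalgebra br alpha,
      forall p q x y, x \in G p -> y \in G q ->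
        br x y = - (ksgn p q *: br y x)
    & forall p q r x y z, x \in G p -> y \in G q -> z \in G r ->
        br (alpha x) (br y z) =
        br (br x y) (alpha z) + ksgn p q *: br (alpha y) (br x z)].

Definition hom_assoc (mu : V -> V -> V) (alpha : 'End(V)) :=
  [/\ hom_superalgebra mu alpha,
      forall p q x y, x \in G p -> y \in G q ->
        mu x y = ksgn p q *: mu y x
    & forall p q r x y z, x \in G p -> y \in G q -> z \in G r ->
        mu (mu x y) (alpha z) = mu (alpha x) (mu y z)].

Definition hom_Poisson (br mu : V -> V -> V) (alpha : 'End(V)) :=
  [/\ hom_Lie br alpha, hom_assoc mu alpha
    & forall p q r x y z, x \in G p -> y \in G q -> z \in G r ->
        br (alpha x) (mu y z) =
        mu (br x y) (alpha z) + ksgn p q *: mu (alpha y) (br x z)].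

Definition hom_anti_pre_Lie (circ : V -> V -> V) (alpha : 'End(V)) :=
  [/\ hom_superalgebra circ alpha,
      forall p q r x y z, x \in G p -> y \in G q -> z \in G r ->
        circ (alpha x) (circ y z) - ksgn p q *: circ (alpha y) (circ x z) =
        ksgn p q *: circ (scomm circ q p y x) (alpha z)
    & forall p q r x y z, x \in G p -> y \in G q -> z \in G r ->
        circ (scomm circ p q x y) (alpha z)
        + ksgn p (q (+) r) *: circ (scomm circ q r y z) (alpha x)
        + ksgn r (p (+) q) *: circ (scomm circ r p z x) (alpha y) = 0].

Definition hom_anti_Zinbiel (star : V -> V -> V) (alpha : 'End(V)) :=
  [/\ hom_superalgebra star alpha,
      forall p q r x y z, x \in G p -> y \in G q -> z \in G r ->
        star (alpha x) (star y z) = - star (santi star p q x y) (alpha z)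
    & forall p q r x y z, x \in G p -> y \in G q -> z \in G r ->
        star (alpha x) (star y z) =
        ksgn p (q (+) r) *: star (alpha y) (star z x)].

Definition hom_anti_pre_Poisson (circ star : V -> V -> V) (alpha : 'End(V)) :=
  [/\ hom_anti_pre_Lie circ alpha,
      hom_anti_Zinbiel star alpha,
      forall p q r x y z, x \in G p -> y \in G q -> z \in G r ->
        star (scomm circ p q x y) (alpha z) =
        ksgn p q *: star (alpha y) (circ x z) - circ (alpha x) (star y z),
      forall p q r x y z, x \in G p -> y \in G q -> z \in G r ->
        circ (santi star p q x y) (alpha z) =
        - star (alpha x) (circ y z) - ksgn p q *: star (alpha y) (circ x z)
    & forall p q r x y z, x \in G p -> y \in G q -> z \in G r ->
        ksgn q r *: star (alpha x) (circ z y)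
        + ksgn p (q (+) r) *: star (alpha y) (circ z x) =
        ksgn r (p (+) q) *: circ (alpha z) (santi star p q x y)
        - circ (santi star p q x y) (alpha z)].

(* As G p and G q span V, this determines br and mu among bilinear maps, so it
   also expresses that (br, mu) is the sub-adjacent structure of
   (circ, star). *)
Definition compatible (circ star br mu : V -> V -> V) :=
  forall p q x y, x \in G p -> y \in G q ->
    scomm circ p q x y = br x y /\ santi star p q x y = mu x y.

Definition bilinear_form (B : V -> V -> K) := bilinear_for *%R *%R B.

Definition nondegenerate_form (B : V -> V -> K) :=
  (forall x, (forall y, B x y = 0) -> x = 0) /\
  (forall y, (forall x, B x y = 0) -> y = 0).

Definition even_form (B : V -> V -> K) :=
  forall p x y, x \in G p -> y \in G (~~ p) -> B x y = 0.

Definition supersymmetric (B : V -> V -> K) :=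
  forall p q x y, x \in G p -> y \in G q -> B x y = ksgn p q * B y x.

Definition two_cocycle (br : V -> V -> V) (alpha : 'End(V)) (B : V -> V -> K) :=
  [/\ bilinear_form B, even_form B, supersymmetric B
    & forall p q r x y z, x \in G p -> y \in G q -> z \in G r ->
        B (alpha x) (br y z)
        + ksgn p (q (+) r) * B (alpha y) (br z x)
        + ksgn r (p (+) q) * B (alpha z) (br x y) = 0].

Definition Connes_cocycle (mu : V -> V -> V) (alpha : 'End(V))
    (B : V -> V -> K) :=
  [/\ bilinear_form B, even_form B, supersymmetric B
    & forall p q r x y z, x \in G p -> y \in G q -> z \in G r ->
        B (mu x y) (alpha z)
        + ksgn p (q (+) r) * B (mu y z) (alpha x)
        + ksgn r (p (+) q) * B (mu z x) (alpha y) = 0].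

(* B is preserved by the twisting map, as dsum_form below is by dsum_alpha.
   When B is nondegenerate this makes alpha injective, hence bijective. *)
Definition twist_invariant (alpha : 'End(V)) (B : V -> V -> K) :=
  forall x y, B (alpha x) (alpha y) = B x y.

(* The component of parity p of a vector. *)
Definition hproj (p : bool) : 'End(V) := daddv_pi (G p) (G (~~ p)).

Lemma super_grading_cap p : super_grading -> (G p :&: G (~~ p) = 0)%VS.
Proof. by case=> _; case: p => //=; rewrite capvC. Qed.

Lemma super_grading_add p : super_grading -> (G p + G (~~ p) = fullv)%VS.
Proof. by case=> + _; case: p => //=; rewrite addvC. Qed.

Lemma hproj_hom p q x :
  super_grading -> x \in G p -> hproj q x = if q == p then x else 0.
Proof.
move=> gG xp; have idx : hproj p x = x.
  by rewrite /hproj daddv_pi_id // super_grading_cap.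
have [-> //|qp] := eqVneq q p.
have {qp} -> : q = ~~ p by case: (q) (p) qp => [] [].
apply: (@addrI _ x); rewrite addr0 -{1}idx /hproj negbK.
by rewrite daddv_pi_add ?super_grading_cap // super_grading_add ?memvf.
Qed.

End Superspaces.

(* The bilinear map whose value at homogeneous u, w is (-1)^{|u||w|} f(u, w). *)
Definition koszul (K : fieldType) (U W : vectType K) (Z : lmodType K)
    (GU : bool -> {vspace U}) (GW : bool -> {vspace W})
    (f : U -> W -> Z) (u : U) (w : W) : Z :=
  \sum_(i : bool) \sum_(j : bool)
    ksgn i j *: f (hproj GU i u) (hproj GW j w).

Lemma koszul_hom (K : fieldType) (U W : vectType K) (Z : lmodType K)
    (GU : bool -> {vspace U}) (GW : bool -> {vspace W}) (f : U -> W -> Z)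
    p q u w :
  super_grading GU -> super_grading GW -> bilinear_for *:%R *:%R f ->
  u \in GU p -> w \in GW q -> koszul GU GW f u w = ksgn p q *: f u w.
Proof.
move=> gU gW [fl fr] up wq.
have f0 x : f 0 x = 0.
  by have := fl x (-1) 0 0; rewrite /= scaler0 addr0 scaleN1r addNr.
have f1 x : f x 0 = 0.
  by have := fr x (-1) 0 0; rewrite /= scaler0 addr0 scaleN1r addNr.
rewrite /koszul (bigD1 p) //= (bigD1 q) //= !(hproj_hom _ gU up).
rewrite !(hproj_hom _ gW wq) !eqxx !big1 ?addr0 //.
- move=> i ip; apply: big1 => j _.
  by rewrite (hproj_hom _ gU up) (negPf ip) f0 scaler0.
- by move=> j jq; rewrite (hproj_hom _ gW wq) (negPf jq) f1 scaler0.
Qed.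

Section Dual.
Variables (K : fieldType) (V : vectType K) (G : bool -> {vspace V}).

Local Notation dual := 'Hom(V, K^o).

(* The linear forms of parity p are those vanishing on G (~~ p). *)
Definition dual_grading (p : bool) : {vspace dual} :=
  lker (linfun (fun xi : dual => (xi \o projv (G (~~ p)))%VF)).

Lemma memv_dual_grading p (xi : dual) :
  reflect (forall v, v \in G (~~ p) -> xi v = 0) (xi \in dual_grading p).
Proof.
have lin_comp : linear (fun xi : dual => (xi \o projv (G (~~ p)))%VF).
  by move=> a u v; rewrite comp_lfunDl comp_lfunZl.
pose F := HB.pack (fun xi : dual => (xi \o projv (G (~~ p)))%VF)
  (GRing.isLinear.Build _ _ _ _ _ lin_comp) : {linear dual -> dual}.
rewrite memv_ker -[linfun _]/(linfun F) lfunE /=.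
apply: (iffP eqP) => [xi0 v vG | xi0].
  by have /lfunP/(_ v) := xi0; rewrite !lfunE /= projv_id.
by apply/lfunP=> v; rewrite !lfunE /= xi0 // memv_proj.
Qed.

Lemma super_grading_dual : super_grading G -> super_grading dual_grading.
Proof.
move=> gG; split.
  apply/eqP; rewrite eqEsubv subvf; apply/subvP=> xi _.
  have -> : xi = (xi \o hproj G false)%VF + (xi \o hproj G true)%VF.
    apply/lfunP=> v; rewrite add_lfunE !comp_lfunE -linearD /= /hproj.
    rewrite (daddv_pi_add (super_grading_cap false gG)) //.
    by rewrite (super_grading_add false gG) memvf.
  by rewrite memv_add //; apply/memv_dual_grading=> v vG;
    rewrite comp_lfunE (hproj_hom _ gG vG) linear0.
apply/eqP; rewrite -subv0; apply/subvP=> xi; rewrite memv_cap memv0.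
case/andP=> /memv_dual_grading x1 /memv_dual_grading x0.
apply/eqP/lfunP=> v; rewrite lfunE /=.
have := memvf v; rewrite -(super_grading_add false gG) => /memv_addP[a aG [b bG ->]].
by rewrite linearD /= (x0 a) // (x1 b) // addr0.
Qed.

(* <L^*(x) xi, v> = - (-1)^{|x||xi|} <xi, x v>, then
   L^\star(x) xi = L^*(alpha x) ((alpha^{-2})^* xi); the transpose of f is
   precomposition with f. *)
Definition dualL (op : V -> V -> V) (x : V) (xi : dual) : dual :=
  linfun (fun v : V =>
    - koszul G dual_grading (fun x' xi' => xi' (op x' v)) x xi).

Lemma dualL_hom (op : V -> V -> V) p q x (xi : dual) v :
  super_grading G -> bilinear_op op -> x \in G p -> xi \in dual_grading q ->
  dualL op x xi v = - (ksgn p q * xi (op x v)).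
Proof.
move=> gG [opl opr] xp xiq; rewrite /dualL.
have kE w : koszul G dual_grading (fun x' (xi' : dual) => xi' (op x' w)) x xi
    = ksgn p q *: xi (op x w).
  rewrite (koszul_hom gG (super_grading_dual gG) _ xp xiq) //.
  split=> [zeta a u u' | u a zeta zeta'] /=; first by rewrite opl linearP.
  by rewrite add_lfunE scale_lfunE.
have lin_k : linear (fun w : V =>
    - koszul G dual_grading (fun x' (xi' : dual) => xi' (op x' w)) x xi).
  move=> a u w; rewrite !kE opr linearP scalerDr opprD scalerN !scalerA.
  by rewrite mulrC.
pose F := HB.pack (fun w : V =>
    - koszul G dual_grading (fun x' (xi' : dual) => xi' (op x' w)) x xi)
  (GRing.isLinear.Build _ _ _ _ _ lin_k) : {linear V -> K^o}.
by rewrite -[linfun _]/(linfun F) lfunE /= kE.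
Qed.

Definition dualLstar (alpha : 'End(V)) (op : V -> V -> V)
    (x : V) (xi : dual) : dual :=
  dualL op (alpha x) (xi \o (alpha^-1 \o alpha^-1))%VF.

Local Notation dsum := (V * dual)%type.

Definition dsum_grading (p : bool) : {vspace dsum} :=
  (linfun (fst : dsum -> V) @^-1: G p
   :&: linfun (snd : dsum -> dual) @^-1: dual_grading p)%VS.

Lemma memv_dsum_grading p (u : dsum) :
  (u \in dsum_grading p) = (u.1 \in G p) && (u.2 \in dual_grading p).
Proof. by rewrite memv_cap -!memv_preim !lfunE. Qed.

Definition dsum_alpha (alpha : 'End(V)) : 'End(dsum) :=
  linfun (fun u : dsum => (alpha u.1, (u.2 \o alpha^-1)%VF)).

Definition dsum_bracket (alpha : 'End(V)) (circ br : V -> V -> V)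
    (u w : dsum) : dsum :=
  (br u.1 w.1,
   - dualLstar alpha circ u.1 w.2
   + koszul dual_grading G (fun xi y => dualLstar alpha circ y xi) u.2 w.1).

Definition dsum_product (alpha : 'End(V)) (star mu : V -> V -> V)
    (u w : dsum) : dsum :=
  (mu u.1 w.1,
   dualLstar alpha star u.1 w.2
   + koszul dual_grading G (fun xi y => dualLstar alpha star y xi) u.2 w.1).

(* <x, zeta> + <xi, y> with <x, zeta> = (-1)^{|x||zeta|} zeta(x). *)
Definition dsum_form (u w : dsum) : K :=
  koszul G dual_grading (fun x (zeta : dual) => zeta x) u.1 w.2 + u.2 w.1.

End Dual.

(* Main.v *)
Require Import Defs.
From HB Require Import structures.
From mathcomp Require Import all_boot all_order all_algebra ring.
Import GRing.Theory.
Local Open Scope ring_scope.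

Set Implicit Arguments.
Unset Strict Implicit.
Unset Printing Implicit Defensive.

(* (i) Nondegeneracy turns the two displayed formulas into definitions of the
   operations, and lets every axiom be tested by pairing it with
   alpha^2(w).  The axioms then become identities among the values of B on
   nested products of four elements.  Those that do not follow from the
   Jacobi, associativity and Leibniz identities alone are linear consequences
   of these together with the cocycle conditions on triples such as
   (alpha a, alpha b, [c, d]); solving for them requires dividing by 2.
   (ii) A form xi on A^* paired with alpha^4(w), on elements alpha^2(x),
   alpha^2(y), makes all inverses of alpha disappear, so that each axiom of the
   semidirect product becomes xi applied to one of the axioms of
   (circ, star). *)

(** The displayed formulas say that left multiplication by [x] in [circ] and in [star] is, up to
    sign and twist, the transpose under [B] of the left multiplication by [x] in [br] and in [mu].
    Transposition reverses composition, so an axiom on nested products of x, y, z turns into a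
    relation in [br] and [mu] on x, y, w, paired with z. Twist invariance is what balances the
    powers of alpha: it makes the transposed operations commute with alpha, and it turns the third
    term of a cocycle condition on (alpha a, alpha b, [c, d]) into a value such as
    [B (br a b) (br c d)]. The 2 appears when such values are eliminated. For the cyclic sum S to be
    shown zero, the cocycle conditions on the pairs containing one chosen element and those on the
    complementary pairs give S = R and S = -R with the same R, whence 2S = 0. Identities between
    vectors are read through scalars, namely values of [B] or of arbitrary linear forms, so that
    each becomes a field identity that [ring] decides once the parities are fixed. *)

Section LinearCombination.
Variable R : fieldType.
Implicit Types a b c d l r : R.

Lemma eq_scale c {a b} : a = b -> c * a = c * b.
Proof. by move->. Qed.

Lemma eq_add {a b c d} : a = b -> c = d -> a + c = b + d.
Proof. by move=> -> ->. Qed.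

(** This is the form of a linear-combination certificate: [l = r] is a weighted sum of known
    equations, and what remains to check is a ring identity. *)
Lemma eq_by_combination {a b l r} : l = r -> a - b = l - r -> a = b.
Proof. by move=> ->; rewrite subrr => /subr0_eq. Qed.

End LinearCombination.

(** Splitting every parity in the goal makes each Koszul sign a literal 1 or -1; values of [B] or of
    linear forms are left as atoms for [ring]. *)
Ltac parity_ring :=
  repeat match goal with p : bool |- _ =>
    match goal with |- context [p] => case: (p) end end;
  rewrite /ksgn /=; ring.

(** The rules are bundled into one tuple so that the rules of several operations can be joined and
    used in a single normalising rewrite. *)
Lemma bilinear_opE (K : fieldType) (U W : lmodType K) (Z : lmodType K)
    (f : U -> W -> Z) : bilinear_for *:%R *:%R f ->
  ((forall w, {morph f^~ w : u v / (u + v)%R}) * (forall w, {morph f^~ w : u / (- u)%R}) *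
   (forall a w, {morph f^~ w : u / (a *: u)%R}) * (forall w, f 0 w = 0) *
   (forall u, {morph f u : v w / (v + w)%R}) * (forall u, {morph f u : w / (- w)%R}) *
   (forall a u, {morph f u : w / (a *: w)%R}) * (forall u, f u 0 = 0))%type.
Proof.
move=> [fl fr].
have l0 w : f 0 w = 0.
  by have := fl w (-1) 0 0; rewrite /= scaler0 addr0 scaleN1r addNr.
have r0 u : f u 0 = 0.
  by have := fr u (-1) 0 0; rewrite /= scaler0 addr0 scaleN1r addNr.
have lZ a w : {morph f^~ w : u / (a *: u)%R}.
  by move=> u; have := fl w a u 0; rewrite /= l0 !addr0.
have rZ a u : {morph f u : w / (a *: w)%R}.
  by move=> w; have := fr u a w 0; rewrite /= r0 !addr0.
do !split=> //.
- by move=> w u v; have := fl w 1 u v; rewrite /= !scale1r.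
- by move=> w u; rewrite /= -scaleN1r lZ scaleN1r.
- by move=> u v w; have := fr u 1 v w; rewrite /= !scale1r.
- by move=> u w; rewrite -scaleN1r rZ scaleN1r.
Qed.

Lemma bilinear_formE (K : fieldType) (V : vectType K) (B : V -> V -> K) :
  bilinear_form B ->
  ((forall w, {morph B^~ w : u v / (u + v)%R}) * (forall w, {morph B^~ w : u / (- u)%R}) *
   (forall a w, {morph B^~ w : u / (a *: u)%R >-> (a * u)%R}) * (forall w, B 0 w = 0) *
   (forall u, {morph B u : v w / (v + w)%R}) * (forall u, {morph B u : w / (- w)%R}) *
   (forall a u, {morph B u : w / (a *: w)%R >-> (a * w)%R}) * (forall u, B u 0 = 0))%type.
Proof. exact: (@bilinear_opE K V V K^o B). Qed.

Lemma koszul_bilinear (K : fieldType) (U W : vectType K) (Z : lmodType K)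
    (GU : bool -> {vspace U}) (GW : bool -> {vspace W}) (f : U -> W -> Z) :
  bilinear_for *:%R *:%R f -> bilinear_for *:%R *:%R (koszul GU GW f).
Proof.
move=> fB; split=> [w a u v|u a v w] /=; rewrite /koszul scaler_sumr -big_split;
  apply: eq_bigr => i _; rewrite /= scaler_sumr -big_split; apply: eq_bigr => j _;
  by rewrite /= !linearP !(bilinear_opE fB) scalerDr !scalerA mulrC.
Qed.

(** * Reduction to homogeneous elements *)

Section Grading.
Variables (K : fieldType) (V : vectType K) (G : bool -> {vspace V}).
Hypothesis gG : super_grading G.

Lemma super_decomp v : exists v0 v1, [/\ v0 \in G false, v1 \in G true & v = v0 + v1].
Proof.
have := memvf v; rewrite -(super_grading_add false gG).
by move=> /memv_addP[a aG [b bG ->]]; exists a, b.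
Qed.

Lemma super_additive_eq (Z : zmodType) (f g : V -> Z) :
  {morph f : u v / (u + v)%R} -> {morph g : u v / (u + v)%R} ->
  (forall p v, v \in G p -> f v = g v) -> f =1 g.
Proof.
move=> fD gD fg v; have [a [b [aG bG ->]]] := super_decomp v.
by rewrite fD gD (fg _ _ aG) (fg _ _ bG).
Qed.

Variable alpha : 'End(V).
Hypotheses (alpha_inj : lker alpha == 0%VS) (alpha_even : even_map G alpha).

(** An injective even map sends each [G p] into itself, hence onto itself by dimension, so the
    inverse does not leave [G p] either. *)
Lemma even_inv : even_map G (alpha^-1)%VF.
Proof.
move=> p x xp; have e : (alpha @: G p)%VS = G p.
  apply/eqP; rewrite eqEdim limg_dim_eq ?leqnn ?andbT; last first.
    by rewrite (eqP alpha_inj) capv0.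
  by apply/subvP=> _ /memv_imgP[y yp ->]; apply: alpha_even.
by move: xp; rewrite -{1}e => /memv_imgP[y yp ->]; rewrite lker0_lfunK.
Qed.

End Grading.

(** * Operations defined by transposition through a nondegenerate form *)

Section FormOperations.
Variables (K : fieldType) (V : vectType K) (B : V -> V -> K).
Hypotheses (Bbil : bilinear_form B) (Bnd : nondegenerate_form B).

Lemma form_injl u v : (forall w, B u w = B v w) -> u = v.
Proof.
move=> e; apply: subr0_eq; apply: Bnd.1 => w.
by rewrite !(bilinear_formE Bbil) e subrr.
Qed.

(** The map u |-> B(u, -) is injective into a dual space of the same dimension, hence bijective;
    [op x y] is the preimage of the linear form [F x y], and bilinearity passes through the
    inverse. *)
Lemma form_represents_op (F : V -> V -> V -> K) :
  (forall w, bilinear_for *%R *%R (fun x y => F x y w)) ->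
  (forall x y, scalar (F x y)) ->
  exists2 op, bilinear_op op & forall x y w, B (op x y) w = F x y w.
Proof.
move=> Fbil Flin.
have Blin u : linear (B u : V -> K^o) := Bbil.2 u.
pose fB u : 'Hom(V, K^o) :=
  linfun (HB.pack (B u : V -> K^o) (GRing.isLinear.Build _ _ _ _ _ (Blin u))
    : {linear V -> K^o}).
have fBE u w : fB u w = B u w by rewrite lfunE.
have fBlin : linear fB.
  move=> a u v; apply/lfunP=> w.
  by rewrite add_lfunE scale_lfunE !fBE !(bilinear_formE Bbil).
pose T : 'Hom(V, 'Hom(V, K^o)) :=
  linfun (HB.pack fB (GRing.isLinear.Build _ _ _ _ _ fBlin)
    : {linear V -> 'Hom(V, K^o)}).
have TE u w : T u w = B u w by rewrite lfunE /= fBE.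
have Tinj : lker T == 0%VS.
  apply/lker0P=> u v e; apply: form_injl => w.
  by rewrite -!TE e.
have Tsurj : limg T = fullv.
  apply/eqP; rewrite eqEdim subvf /= limg_dim_eq; last first.
    by rewrite (eqP Tinj) capv0.
  by rewrite !dimvf /dim /= muln1.
have FL x y : linear (F x y : V -> K^o) := Flin x y.
pose fF x y : 'Hom(V, K^o) :=
  linfun (HB.pack (F x y : V -> K^o) (GRing.isLinear.Build _ _ _ _ _ (FL x y))
    : {linear V -> K^o}).
have fFE x y w : fF x y w = F x y w by rewrite lfunE.
pose op x y := (T^-1)%VF (fF x y).
exists op => [|x y w].
  split=> [y a x x'|x a y y'] /=; rewrite /op -linearP; congr (_ _);
    apply/lfunP=> w; rewrite add_lfunE scale_lfunE !fFE.
  - exact: (Fbil w).1.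
  - exact: (Fbil w).2.
by rewrite -TE limg_lfunVK ?Tsurj ?memvf // fFE.
Qed.

Variable G : bool -> {vspace V}.
Hypotheses (gG : super_grading G) (Beven : even_form G B).

Lemma form_injl_hom (alpha : 'End(V)) u v : lker alpha == 0%VS -> even_map G alpha ->
  (forall t w, w \in G t -> B u (alpha w) = B v (alpha w)) -> u = v.
Proof.
move=> ai ae e; apply: form_injl => w; move: w.
apply: (super_additive_eq gG) => [w w'|w w'|t w wt]; rewrite ?(bilinear_formE Bbil) //.
by rewrite -(lker0_lfunVK ai w) (e t) // even_inv.
Qed.

(** The component of [u] of the wrong parity pairs to zero with [G r] by evenness, and with
    [G (~~ r)] because both [u] and its component in [G r] do. Nondegeneracy then kills it. *)
Lemma form_parity r u : (forall w, w \in G (~~ r) -> B u w = 0) -> u \in G r.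
Proof.
move=> u0; have [a [b [aG bG ue]]] := super_decomp gG u.
pose c p := if p then b else a.
have cG p : c p \in G p by case: p.
have cE : u = c r + c (~~ r) by rewrite ue; case: (r) => //=; rewrite addrC.
suff c0 : c (~~ r) = 0 by rewrite cE c0 addr0.
apply: form_injl => w; rewrite (bilinear_formE Bbil); move: w.
apply: (super_additive_eq gG) => [w w'|w w'|t w wt];
  rewrite ?(bilinear_formE Bbil) ?addr0 //.
have [te|/eqP tn] := eqVneq t r.
  by apply: (Beven (p := ~~ r)); rewrite ?cG // negbK -te.
have wr : w \in G (~~ r) by case: (t) (r) tn wt => [] [].
by have := u0 w wr; rewrite cE (bilinear_formE Bbil) (Beven (p := r)) ?add0r.
Qed.

Variable alpha : 'End(V).
Hypotheses (ai : lker alpha == 0%VS) (ae : even_map G alpha)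
  (Binv : twist_invariant alpha B).

(** One construction serves both operations: [m] is [br] for [circ] and the opposite of [mu] for
    [star]. The defining equation is the displayed one with one alpha cancelled on each side of [B],
    which twist invariance and compatibility with alpha permit. *)
Lemma dual_op_exists (m : V -> V -> V) : bilinear_op m -> even_op G m ->
  {morph alpha : x y / m x y} ->
  exists op, [/\ bilinear_op op, even_op G op, {morph alpha : x y / op x y}
    & forall p q x y w, x \in G p -> y \in G q ->
       B (op x y) (alpha w) = ksgn p q * B (alpha y) (m x w)].
Proof.
move=> mbil meven mmorph.
have bil w : bilinear_for *:%R *:%R
    (fun x y => B (alpha y) (m x ((alpha^-1)%VF w)) : K^o).
  by split=> [y a x x'|x a y y'] /=; rewrite ?linearP
    !(bilinear_formE Bbil, bilinear_opE mbil).
(* The sign is defined only on homogeneous pairs, so [koszul] extends it bilinearly; the inverse of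
   alpha compensates for pairing with [alpha w]. *)
pose F x y w := koszul G G (fun x y => B (alpha y) (m x ((alpha^-1)%VF w)) : K^o) x y.
have [|x y a u v|op opbil opE0] := @form_represents_op F.
- by move=> w; exact: (koszul_bilinear G G (bil w)).
- rewrite /F /koszul mulr_sumr -big_split; apply: eq_bigr => i _.
  rewrite /= mulr_sumr -big_split; apply: eq_bigr => j _.
  rewrite /= linearP !(bilinear_formE Bbil, bilinear_opE mbil).
  by rewrite /GRing.scale /=; ring.
have opE p q x y w : x \in G p -> y \in G q ->
    B (op x y) (alpha w) = ksgn p q * B (alpha y) (m x w).
  move=> xp yq; rewrite opE0 /F (koszul_hom gG gG (bil _) xp yq).
  by rewrite lker0_lfunK.
exists op; split=> // [p q x y xp yq|].
  apply: form_parity => w wG.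
  rewrite -(lker0_lfunVK ai w) (opE p q) //.
  have wG' := even_inv ai ae wG.
  rewrite (Beven (p := q)) ?mulr0 ?ae //.
  have := meven _ _ _ _ xp wG'.
  by case: (p) (q) => [] [].
move=> x y; move: x; apply: (super_additive_eq gG) => [x x'|x x'|p x xp];
  rewrite ?linearD ?(bilinear_opE opbil) ?linearD //.
move: y; apply: (super_additive_eq gG) => [y y'|y y'|q y yq];
  rewrite ?linearD ?(bilinear_opE opbil) ?linearD //.
(* To compare [alpha (op x y)] with [op (alpha x) (alpha y)], the test vector is written as alpha^2
   of another one: each side then reduces, by invariance, to the same value of [B] on [alpha y] and
   [m x] of that vector. *)
apply: form_injl => w; rewrite -(lker0_lfunVK ai w); set v := (_ w).
rewrite Binv -(lker0_lfunVK ai v) (opE p q) // (opE p q) ?ae // -mmorph Binv.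
by [].
Qed.

End FormOperations.

(** * From the two cocycle conditions to the anti-pre-Poisson axioms *)

Section CocyclesToAntiPrePoisson.
Variables (K : fieldType) (V : vectType K) (G : bool -> {vspace V}).
Variables (alpha : 'End(V)) (br mu : V -> V -> V) (B : V -> V -> K).
Hypotheses (two_neq0 : 2%:R != 0 :> K) (poisson : hom_Poisson G br mu alpha)
  (br_alpha : {morph alpha : x y / br x y})
  (mu_alpha : {morph alpha : x y / mu x y})
  (Bnd : nondegenerate_form B) (cocB : two_cocycle G br alpha B)
  (connesB : Connes_cocycle G mu alpha B) (Binv : twist_invariant alpha B).

Let gG : super_grading G. Proof. by case: poisson => [[[]]]. Qed.
Let ae : even_map G alpha. Proof. by case: poisson => [[[]]]. Qed.
Let brbil : bilinear_op br. Proof. by case: poisson => [[[]]]. Qed.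
Let mubil : bilinear_op mu. Proof. by case: poisson => [_ [[]]]. Qed.
Let breven : even_op G br. Proof. by case: poisson => [[[]]]. Qed.
Let mueven : even_op G mu. Proof. by case: poisson => [_ [[]]]. Qed.
Let Bbil : bilinear_form B. Proof. by case: cocB. Qed.
Let Beven : even_form G B. Proof. by case: cocB. Qed.
Let Bsym : supersymmetric G B. Proof. by case: cocB. Qed.
Let ai : lker alpha == 0%VS.
Proof.
apply/lker0P=> x y xy; apply: (form_injl Bbil Bnd) => w.
by rewrite -Binv xy Binv.
Qed.

Let brC p q x y : x \in G p -> y \in G q -> br x y = - (ksgn p q *: br y x).
Proof. by case: poisson => [[_ h _] _ _]; apply: h. Qed.
Let muC p q x y : x \in G p -> y \in G q -> mu x y = ksgn p q *: mu y x.
Proof. by case: poisson => [_ [_ h _] _]; apply: h. Qed.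
Let jacobi p q r x y z : x \in G p -> y \in G q -> z \in G r ->
  br (alpha x) (br y z) = br (br x y) (alpha z) + ksgn p q *: br (alpha y) (br x z).
Proof. by case: poisson => [[_ _ h] _ _]; apply: h. Qed.
Let assoc p q r x y z : x \in G p -> y \in G q -> z \in G r ->
  mu (mu x y) (alpha z) = mu (alpha x) (mu y z).
Proof. by case: poisson => [_ [_ _ h] _]; apply: h. Qed.
Let leibniz p q r x y z : x \in G p -> y \in G q -> z \in G r ->
  br (alpha x) (mu y z) = mu (br x y) (alpha z) + ksgn p q *: mu (alpha y) (br x z).
Proof. by case: poisson => [_ _ h]; apply: h. Qed.
Let coc p q r x y z : x \in G p -> y \in G q -> z \in G r ->
  B (alpha x) (br y z) + ksgn p (q (+) r) * B (alpha y) (br z x)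
  + ksgn r (p (+) q) * B (alpha z) (br x y) = 0.
Proof. by case: cocB => _ _ _; apply. Qed.
Let connes p q r x y z : x \in G p -> y \in G q -> z \in G r ->
  B (mu x y) (alpha z) + ksgn p (q (+) r) * B (mu y z) (alpha x)
  + ksgn r (p (+) q) * B (mu z x) (alpha y) = 0.
Proof. by case: connesB => _ _ _; apply. Qed.

(** Nested products occur in four shapes: [Q] and [M] stay within one operation, while [P] and [W]
    mix the two, with the bracket innermost and outermost respectively. *)
Local Notation Q a b c d := (B (alpha (alpha a)) (br (alpha b) (br c d))).
Local Notation M a b c d := (B (alpha (alpha a)) (mu (alpha b) (mu c d))).
Local Notation P a b c d := (B (alpha (alpha a)) (mu (alpha b) (br c d))).
Local Notation W a b c d := (B (alpha (alpha a)) (br (alpha b) (mu c d))).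

Let bilE := (bilinear_opE brbil, bilinear_opE mubil, bilinear_formE Bbil).

Section FourElements.
Variables (p q r t : bool) (a b c d : V).
Hypotheses (ap : a \in G p) (bq : b \in G q) (cr : c \in G r) (dt : d \in G t).

Lemma Qanti : Q a b c d = - (ksgn r t * Q a b d c).
Proof. by rewrite (brC cr dt) !bilE. Qed.

Lemma Panti : P a b c d = - (ksgn r t * P a b d c).
Proof. by rewrite (brC cr dt) !bilE. Qed.

Lemma Mcomm : M a b c d = ksgn r t * M a b d c.
Proof. by rewrite (muC cr dt) !bilE. Qed.

(** Together with [Mcomm] this makes [M a b c d] supersymmetric in its last three arguments, so up
    to sign it depends only on which element stands first. *)
Lemma Massoc : M a b c d = ksgn q r * M a c b d.
Proof. by rewrite -(assoc bq cr dt) (muC bq cr) !bilE (assoc cr bq dt). Qed.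

Lemma Qjacobi :
  Q a b c d + ksgn (q (+) r) t * Q a d b c = ksgn q r * Q a c b d.
Proof.
rewrite (jacobi bq cr dt) (brC (breven bq cr) (ae dt)) !bilE.
by parity_ring.
Qed.

Lemma Wleibniz :
  W a b c d = ksgn (q (+) r) t * P a d b c + ksgn q r * P a c b d.
Proof. by rewrite (leibniz bq cr dt) (muC (breven bq cr) (ae dt)) !bilE. Qed.

Lemma Rsym : B (br a b) (br c d) =
  ksgn (p (+) q) (r (+) t) * B (br c d) (br a b).
Proof. by rewrite (Bsym (breven ap bq) (breven cr dt)). Qed.

Lemma Nsym : B (mu a b) (mu c d) =
  ksgn (p (+) q) (r (+) t) * B (mu c d) (mu a b).
Proof. by rewrite (Bsym (mueven ap bq) (mueven cr dt)). Qed.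

(** In the cocycle condition on (alpha a, alpha b, [c, d]) the third term is [B] on two images of
    alpha, by compatibility of the bracket with alpha, so invariance strips the twist from it. The
    three lemmas after it work the same way. *)
Lemma Qcocycle : Q a b c d - ksgn p q * Q b a c d + B (br a b) (br c d) = 0.
Proof.
have cd := breven cr dt.
rewrite -(coc (ae ap) (ae bq) cd) -br_alpha Binv Rsym // (brC cd (ae ap)) !bilE.
by parity_ring.
Qed.

Lemma Mcocycle : M a b c d + ksgn p q * M b a c d + B (mu a b) (mu c d) = 0.
Proof.
have cd := mueven cr dt.
rewrite -(connes (ae ap) (ae bq) cd) -mu_alpha Binv (muC cd (ae ap)) !bilE.
rewrite (Bsym (mueven (ae bq) cd) (ae (ae ap))).
rewrite (Bsym (mueven (ae ap) cd) (ae (ae bq))).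
by parity_ring.
Qed.

Lemma Pcocycle : P a b c d + ksgn p q * P b a c d + B (mu a b) (br c d) = 0.
Proof.
have cd := breven cr dt.
rewrite -(connes (ae ap) (ae bq) cd) -mu_alpha Binv (muC cd (ae ap)) !bilE.
rewrite (Bsym (mueven (ae bq) cd) (ae (ae ap))).
rewrite (Bsym (mueven (ae ap) cd) (ae (ae bq))).
by parity_ring.
Qed.

(** The mixed value [B (mu a b) (br c d)] also occurs in [Pcocycle]; it is the link through which
    the two cocycle conditions interact. *)
Lemma Wcocycle : B (mu a b) (br c d)
  + ksgn (p (+) q) (r (+) t) * W c d a b
  - ksgn r t * ksgn (p (+) q) (r (+) t) * W d c a b = 0.
Proof.
have ab := mueven ap bq.
rewrite -(coc ab (ae cr) (ae dt)) -br_alpha Binv (brC ab (ae cr)) !bilE.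
by parity_ring.
Qed.

End FourElements.

Lemma double_inj (u v : K) : 2 * u = 2 * v -> u = v.
Proof. exact: mulfI. Qed.

(* In each combination the integer factors solve the ungraded linear system, and
   the sign of an instance is, up to a common factor, the Koszul sign of the
   permutation of x, y, z, w listed by its arguments. *)
Section FourIdentities.
Variables (p q r t : bool) (x y z w : V).
Hypotheses (xp : x \in G p) (yq : y \in G q) (zr : z \in G r) (wt : w \in G t).

(** This is the second anti-pre-Lie axiom after pairing. Call the sum S, ignore signs, and let R be
    the sum of B([z,w],[x,y]) over cyclic x, y, z. The cocycle conditions on pairs containing w,
    with Jacobi, give S = -R; those on pairs among x, y, z, again with Jacobi, give S = R. *)
Lemma Qcyclic : ksgn (p (+) q) (r (+) t) * Q z w x y
  + ksgn t (q (+) r) * Q x w y z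
  + ksgn p (q (+) r) * ksgn t (p (+) r) * Q y w z x = 0.
Proof.
apply: double_inj.
have comb := (eq_add (eq_scale (ksgn t r * ksgn t p * ksgn t q * ksgn r p * ksgn r q)
    (Qjacobi w zr xp yq))
  (eq_add (eq_scale (ksgn t p * ksgn t r * ksgn t q * ksgn r q)
    (Qanti w x zr yq))
  (eq_add (eq_scale (- (ksgn r p * ksgn r q * ksgn t q)) (Qjacobi z xp wt yq))
  (eq_add (eq_scale 1 (Rsym xp yq zr wt))
  (eq_add (eq_scale (- (ksgn q p * ksgn r p)) (Qcocycle yq zr xp wt))
  (eq_add (eq_scale (ksgn r q * ksgn t q) (Qjacobi x zr wt yq))
  (eq_add (eq_scale (- (ksgn t q * ksgn t r * ksgn t p * ksgn q p * ksgn r p))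
    (Qcocycle wt yq zr xp))
  (eq_add (eq_scale (ksgn t r * ksgn t q * ksgn r q) (Qanti x w zr yq))
  (eq_add (eq_scale (ksgn q p * ksgn r p) (Qjacobi y zr xp wt))
  (eq_add (eq_scale (- (ksgn r p * ksgn r q * ksgn t q)) (Rsym zr xp wt yq))
  (eq_add (eq_scale (ksgn r p * ksgn r q * ksgn t p * ksgn t q)
    (Qcocycle zr wt xp yq))
  (eq_add (eq_scale (ksgn t q * ksgn t r) (Qcocycle xp wt yq zr))
  (eq_add (eq_scale (-1) (Qcocycle xp yq zr wt))
  (eq_add (eq_scale (- (ksgn t q * ksgn t r)) (Rsym xp wt yq zr))
  (eq_scale (ksgn r p * ksgn r q * ksgn t q)
    (Qcocycle zr xp wt yq)))))))))))))))).
apply: (eq_by_combination comb).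
by parity_ring.
Qed.

(** Up to sign M depends only on its first argument; write m_x for that value. Symmetry of [B] on
    pairs of products and [Mcocycle] give m_x + m_y = m_z + m_w and m_x + m_w = m_z + m_y; adding
    them yields 2 m_x = 2 m_z. *)
Lemma Mrotate : ksgn p (q (+) r) * M z y x w = M x z y w.
Proof.
apply: double_inj.
have comb := (eq_add (eq_scale (-1) (Massoc x zr yq wt))
  (eq_add (eq_scale (ksgn r p * ksgn t q) (Massoc z xp wt yq))
  (eq_add (eq_scale (- ksgn t q) (Massoc x zr wt yq))
  (eq_add (eq_scale (- ksgn r p) (Massoc z xp yq wt))
  (eq_add (eq_scale (-1) (Mcomm x z yq wt))
  (eq_add (eq_scale (ksgn r p) (Mcomm z x yq wt))
  (eq_add (eq_scale (ksgn q p * ksgn q r) (Massoc y xp zr wt))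
  (eq_add (eq_scale (- ksgn q r) (Mcocycle xp yq zr wt))
  (eq_add (eq_scale (ksgn q r) (Nsym xp yq zr wt))
  (eq_add (eq_scale (- (ksgn t r * ksgn t p * ksgn t q * ksgn r p))
    (Massoc w zr xp yq))
  (eq_add (eq_scale (ksgn t r * ksgn t q) (Nsym xp wt zr yq))
  (eq_add (eq_scale (ksgn r p * ksgn t p * ksgn t q) (Mcocycle zr wt xp yq))
  (eq_add (eq_scale (- (ksgn t r * ksgn t q)) (Mcocycle xp wt zr yq))
  (eq_scale (ksgn r p * ksgn q p) (Mcocycle zr yq xp wt))))))))))))))).
apply: (eq_by_combination comb).
by parity_ring.
Qed.

(** No cocycle is involved: Leibniz writes each [W] as two values of [P], and the six cancel in
    pairs by antisymmetry of the inner bracket. *)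
Lemma Wcyclic :
  ksgn t (p (+) q) * W z w x y + ksgn p q * W z y x w + W z x y w = 0.
Proof.
have comb := (eq_add (eq_scale (ksgn t q) (Panti z x wt yq))
  (eq_add (eq_scale (ksgn t p * ksgn t q) (Wleibniz z wt xp yq))
  (eq_add (eq_scale (ksgn t q * ksgn t p * ksgn q p) (Panti z w yq xp))
  (eq_add (eq_scale (ksgn q p * ksgn t p) (Panti z y wt xp))
  (eq_add (eq_scale (ksgn q p) (Wleibniz z yq xp wt))
  (eq_scale 1 (Wleibniz z xp yq wt))))))).
apply: (eq_by_combination comb).
by parity_ring.
Qed.

(** By [Wcocycle] the left side becomes, signs aside, the sum S of W(a, z, -, -) over a in {x, y,
    w}. Let C be the sum of the mixed values [B (mu a b) (br z c)] over the ways of splitting {x, y,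
    w} into a pair {a, b} and c. [Wcocycle] with the vanishing sum of [Wcyclic] gives S = C, and
    [Pcocycle] with Leibniz gives S = -C. *)
Lemma Wcocycle_sum :
  ksgn p (q (+) r) * W y z x w + ksgn q r * W x z y w
  + B (mu x y) (br z w) + ksgn (p (+) q) (r (+) t) * W z w x y = 0.
Proof.
apply: double_inj.
have comb := (eq_add (eq_scale (- (ksgn t r * ksgn t q * ksgn r q))
    (Wcocycle xp wt zr yq))
  (eq_add (eq_scale (ksgn r q * ksgn r p * ksgn q p) (Panti z y xp wt))
  (eq_add (eq_scale (ksgn r p * ksgn r q * ksgn t q) (Panti z x wt yq))
  (eq_add (eq_scale (ksgn r q) (Wleibniz x zr yq wt))
  (eq_add (eq_scale (ksgn r q * ksgn r p * ksgn t q * ksgn t p * ksgn q p)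
    (Panti z w yq xp))
  (eq_add (eq_scale (ksgn r q * ksgn r p * ksgn q p) (Wleibniz z yq xp wt))
  (eq_add (eq_scale (ksgn q p * ksgn t r * ksgn t p * ksgn r p)
    (Pcocycle yq wt zr xp))
  (eq_add (eq_scale (ksgn r p * ksgn r q) (Wleibniz z xp yq wt))
  (eq_add (eq_scale (ksgn t r * ksgn t q * ksgn r q) (Pcocycle xp wt zr yq))
  (eq_add (eq_scale (- (ksgn q p * ksgn t r * ksgn t p * ksgn r p))
    (Wcocycle yq wt zr xp))
  (eq_add (eq_scale 1 (Pcocycle xp yq zr wt))
  (eq_add (eq_scale (ksgn q p * ksgn r p) (Wleibniz y zr xp wt))
  (eq_add (eq_scale (ksgn t r * ksgn t p * ksgn t q * ksgn r p * ksgn r q)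
    (Wleibniz w zr xp yq))
  (eq_add (eq_scale 1 (Wcocycle xp yq zr wt))
  (eq_scale (ksgn r p * ksgn r q * ksgn t p * ksgn t q)
    (Wleibniz z wt xp yq)))))))))))))))).
apply: (eq_by_combination comb).
by parity_ring.
Qed.

End FourIdentities.


(** Moving [o1 (alpha x)] and then [o2 (alpha y)] across [B] reverses their order, which is why [m2]
    ends up outside [m1]. Compatibility with alpha supplies the twist that the second move
    requires. *)
Lemma nested_op (o1 m1 o2 m2 : V -> V -> V) :
  (forall p q x y w, x \in G p -> y \in G q ->
     B (o1 x y) (alpha w) = ksgn p q * B (alpha y) (m1 x w)) ->
  (forall p q x y w, x \in G p -> y \in G q ->
     B (o2 x y) (alpha w) = ksgn p q * B (alpha y) (m2 x w)) ->
  even_op G o2 -> {morph alpha : x y / o2 x y} -> {morph alpha : x y / m1 x y} ->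
  forall p q r x y z w, x \in G p -> y \in G q -> z \in G r ->
    B (o1 (alpha x) (o2 y z)) (alpha (alpha w)) =
    ksgn p (q (+) r) * (ksgn q r * B (alpha (alpha z)) (m2 (alpha y) (m1 x w))).
Proof.
move=> o1E o2E o2even o2_alpha m1_alpha p q r x y z w xp yq zr.
rewrite (o1E _ _ _ _ _ (ae xp) (o2even _ _ _ _ yq zr)) -m1_alpha o2_alpha.
by rewrite (o2E _ _ _ _ _ (ae yq) (ae zr)).
Qed.

Lemma cocycles_anti_pre_Poisson : exists circ star : V -> V -> V,
  [/\ hom_anti_pre_Poisson G circ star alpha,
      compatible G circ star br mu,
      forall p q r x y z, x \in G p -> y \in G q -> z \in G r ->
        B (star (alpha x) (alpha y)) (alpha (alpha z)) =
        - (ksgn p q * B (alpha y) (mu x z))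
    & forall p q r x y z, x \in G p -> y \in G q -> z \in G r ->
        B (circ (alpha x) (alpha y)) (alpha (alpha z)) =
        ksgn p q * B (alpha y) (br x z)].
Proof.
pose nmu x y := - mu x y.
have nmubil : bilinear_op nmu.
  by split=> [y a x x'|x a y y'] /=; rewrite /nmu !bilE opprD scalerN.
have nmueven : even_op G nmu.
  by move=> p q x y xp yq; rewrite rpredN mueven.
have nmu_alpha : {morph alpha : x y / nmu x y}.
  by move=> x y; rewrite /nmu linearN /= mu_alpha.
have [circ [cbil ceven c_alpha cE]] :=
  dual_op_exists Bbil Bnd gG Beven ai ae Binv brbil breven br_alpha.
have [star [sbil seven s_alpha sE]] :=
  dual_op_exists Bbil Bnd gG Beven ai ae Binv nmubil nmueven nmu_alpha.
have cc := nested_op cE cE ceven c_alpha br_alpha.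
have cs := nested_op cE sE seven s_alpha br_alpha.
have sc := nested_op sE cE ceven c_alpha nmu_alpha.
have ss := nested_op sE sE seven s_alpha nmu_alpha.
have oE := (bilinear_opE cbil, bilinear_opE sbil, bilE).
have eqB u v : (forall t w, w \in G t ->
    B u (alpha (alpha w)) = B v (alpha (alpha w))) -> u = v.
  move=> e; apply: (form_injl_hom Bbil Bnd gG ai ae) => t w wt.
  by rewrite -(lker0_lfunVK ai w) (e t) // even_inv.
(* Antisymmetrising the transposed bracket and pairing with [alpha w] gives exactly the 2-cocycle
   condition on (x, y, w); the Connes condition plays the same part for [anti]. *)
have comm p q x y : x \in G p -> y \in G q ->
    scomm circ p q x y = br x y.
  move=> xp yq; apply: (form_injl_hom Bbil Bnd gG ai ae) => t w wt.
  rewrite !oE (cE _ _ _ _ _ xp yq) (cE _ _ _ _ _ yq xp).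
  have comb := eq_scale (-1) (coc xp yq wt); apply: (eq_by_combination comb).
  rewrite (brC wt xp) !bilE (Bsym (ae wt) (breven xp yq)).
  by parity_ring.
have anti p q x y : x \in G p -> y \in G q ->
    santi star p q x y = mu x y.
  move=> xp yq; apply: (form_injl_hom Bbil Bnd gG ai ae) => t w wt.
  rewrite !oE (sE _ _ _ _ _ xp yq) (sE _ _ _ _ _ yq xp) /nmu !bilE.
  have comb := eq_scale (-1) (connes xp yq wt); apply: (eq_by_combination comb).
  rewrite (muC wt xp) !bilE.
  rewrite (Bsym (mueven yq wt) (ae xp)) (Bsym (mueven xp wt) (ae yq)).
  by parity_ring.
exists circ, star; split=> //; first last.
- move=> p q r x y z xp yq zr.
  by rewrite -c_alpha Binv (cE _ _ _ _ _ xp yq).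
- move=> p q r x y z xp yq zr.
  by rewrite -s_alpha Binv (sE _ _ _ _ _ xp yq) /nmu !bilE mulrN.
- by move=> p q x y xp yq; rewrite comm ?anti.
split.
- split=> // p q r x y z xp yq zr.
  (* Transposed, this axiom is the Jacobi identity for (y, x, w), paired with alpha^2(z). *)
  + rewrite comm //; apply: eqB => t w wt; rewrite !oE !(cc _ _ _ _ _ _ _ xp yq zr).
    rewrite (cc _ _ _ _ _ _ _ yq xp zr) (cE _ _ _ _ _ (breven yq xp) (ae zr)).
    have comb := eq_scale (ksgn (p (+) q) r * ksgn p q)
      (congr1 (B (alpha (alpha z))) (jacobi yq xp wt)).
    apply: (eq_by_combination comb); rewrite !bilE.
    by parity_ring.
  + rewrite !comm //; apply: eqB => t w wt; rewrite !oE.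
    rewrite (cE _ _ _ _ _ (breven xp yq) (ae zr)).
    rewrite (cE _ _ _ _ _ (breven yq zr) (ae xp)).
    rewrite (cE _ _ _ _ _ (breven zr xp) (ae yq)).
    rewrite (brC (breven xp yq) (ae wt)) (brC (breven yq zr) (ae wt)).
    rewrite (brC (breven zr xp) (ae wt)) !bilE.
    have comb := eq_scale (-1)
      (Qcyclic xp yq zr wt).
    apply: (eq_by_combination comb).
    by parity_ring.
- split=> // p q r x y z xp yq zr.
  + rewrite anti //; apply: eqB => t w wt; rewrite !oE (ss _ _ _ _ _ _ _ xp yq zr).
    (* Because transposition has reversed the order, x and y are exchanged first, so that
       associativity applies to (y, x, w). *)
    rewrite (sE _ _ _ _ _ (mueven xp yq) (ae zr)) /nmu (muC xp yq) !bilE.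
    rewrite (assoc yq xp wt).
    by parity_ring.
  + apply: eqB => t w wt; rewrite !oE (ss _ _ _ _ _ _ _ xp yq zr).
    rewrite (ss _ _ _ _ _ _ _ yq zr xp) /nmu !bilE.
    have comb := eq_scale (ksgn q r) (Mrotate xp yq zr wt).
    apply: (eq_by_combination comb).
    by parity_ring.
- move=> p q r x y z xp yq zr; rewrite comm //; apply: eqB => t w wt.
  rewrite !oE (sE _ _ _ _ _ (breven xp yq) (ae zr)) (sc _ _ _ _ _ _ _ yq xp zr).
  rewrite (cs _ _ _ _ _ _ _ xp yq zr) /nmu !bilE.
  (* Axiom (1) is the transposed Leibniz rule for (x, y, w). *)
  have comb := eq_scale (ksgn (p (+) q) r)
    (congr1 (B (alpha (alpha z))) (leibniz xp yq wt)).
  apply: (eq_by_combination comb); rewrite !bilE.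
  by parity_ring.
- move=> p q r x y z xp yq zr; rewrite anti //; apply: eqB => t w wt.
  rewrite !oE (cE _ _ _ _ _ (mueven xp yq) (ae zr)) (sc _ _ _ _ _ _ _ xp yq zr).
  rewrite (sc _ _ _ _ _ _ _ yq xp zr) /nmu !bilE (brC (mueven xp yq) (ae wt)) !bilE.
  have comb := eq_scale (- ksgn (p (+) q) r) (Wcyclic z xp yq wt).
  apply: (eq_by_combination comb).
  by parity_ring.
move=> p q r x y z xp yq zr; rewrite anti //; apply: eqB => t w wt.
rewrite !oE (cE _ _ _ _ _ (mueven xp yq) (ae zr)) (cE _ _ _ _ _ (ae zr) (mueven xp yq)).
rewrite (sc _ _ _ _ _ _ _ xp zr yq) (sc _ _ _ _ _ _ _ yq zr xp) /nmu !bilE.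
(* The term [circ (alpha z) (mu x y)] has the product in its right slot, so its pairing is not
   nested: it is the mixed value [B (mu x y) (br z w)] once alpha is removed. *)
rewrite -br_alpha Binv (brC (mueven xp yq) (ae wt)) !bilE.
have comb := eq_scale (-1) (Wcocycle_sum xp yq zr wt).
apply: (eq_by_combination comb).
by parity_ring.
Qed.

End CocyclesToAntiPrePoisson.

Lemma scalarE (K : fieldType) (V : lmodType K) (f : V -> K) : scalar f ->
  ({morph f : u v / (u + v)%R >-> (u + v)%R} * {morph f : u / (- u)%R >-> (- u)%R} *
   (forall a, {morph f : u / (a *: u)%R >-> (a * u)%R}))%type.
Proof.
move=> fl; have f0 : f 0 = 0.
  by have := fl (-1) 0 0; rewrite /= scaler0 addr0 mulN1r addNr.
have fZ a u : f (a *: u) = a * f u by rewrite -[a *: u]addr0 fl f0 addr0.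
do !split=> //; first by move=> u v; have := fl 1 u v; rewrite /= scale1r mul1r.
by move=> u; rewrite -scaleN1r fZ mulN1r.
Qed.

(** Coordinate forms separate vectors; through them an identity in a vector space becomes one in the
    field, where [ring] applies. *)
Lemma eq_by_scalars (K : fieldType) (V : vectType K) (u v : V) :
  (forall f : V -> K, scalar f -> f u = f v) -> u = v.
Proof.
move=> e; rewrite (coord_vbasis (memvf u)) (coord_vbasis (memvf v)).
apply: eq_bigr => i _; congr (_ *: _); apply: e => a x y.
by rewrite linearP.
Qed.

(** Supersymmetry is available only on homogeneous pairs, but against a homogeneous v evenness keeps
    just the component of u of the same parity. The sign therefore depends on v alone, for any u. *)
Lemma form_radical_sym (K : fieldType) (V : vectType K) (G : bool -> {vspace V})
    (B : V -> V -> K) u : super_grading G ->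
  bilinear_form B -> even_form G B -> supersymmetric G B ->
  (forall v, B u v = 0) <-> (forall v, B v u = 0).
Proof.
move=> gG Bbil Beven Bsym.
have BE := bilinear_formE Bbil.
have BC q v : v \in G q -> B u v = ksgn q q * B v u.
  have [a [b [aG bG ->]]] := super_decomp gG u.
  rewrite !BE; case: q => vG.
    rewrite (Beven false a v) // (Beven true v a) // add0r add0r.
    exact: Bsym.
  rewrite (Beven true b v) // (Beven false v b) // !addr0.
  exact: Bsym.
split=> e; apply: (super_additive_eq gG) => [v w|v w|q v vG]; rewrite ?BE ?addr0 //.
  have := BC q v vG; rewrite e => /esym/eqP; rewrite mulf_eq0 => /orP[|/eqP //].
  by rewrite /ksgn signr_eq0.
by rewrite (BC q) // e mulr0.
Qed.

(** * The twisted action on the dual space *)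

Section DualAction.
Variables (K : fieldType) (V : vectType K) (G : bool -> {vspace V}).
Local Notation dual := 'Hom(V, K^o).
Hypothesis gG : super_grading G.
Variable alpha : 'End(V).
Hypotheses (ai : lker alpha == 0%VS) (ae : even_map G alpha).

Lemma dual_grading_eq0 p q (xi : dual) v :
  xi \in dual_grading G p -> v \in G q -> q != p -> xi v = 0.
Proof.
move=> /memv_dual_grading h vq qp; apply: h.
by case: (p) (q) vq qp => [] [].
Qed.

Lemma dual_comp_even p (xi : dual) (f : 'End(V)) : even_map G f ->
  xi \in dual_grading G p -> (xi \o f)%VF \in dual_grading G p.
Proof.
move=> fe /memv_dual_grading h; apply/memv_dual_grading=> v vG.
by rewrite comp_lfunE h // fe.
Qed.

Lemma dual_hom_eq (xi eta : dual) :
  (forall t w, w \in G t -> xi (alpha (alpha (alpha (alpha w)))) =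
                            eta (alpha (alpha (alpha (alpha w))))) -> xi = eta.
Proof.
move=> e; apply/lfunP; apply: (super_additive_eq gG) => [u v|u v|t w wt];
  rewrite ?linearD //.
have inv := even_inv ai ae.
rewrite -(lker0_lfunVK ai w) -[X in alpha X](lker0_lfunVK ai).
rewrite -[X in alpha (alpha X)](lker0_lfunVK ai).
rewrite -[X in alpha (alpha (alpha X))](lker0_lfunVK ai).
by rewrite (e t) // !inv.
Qed.

Section Operation.
Variable op : V -> V -> V.
Hypotheses (opbil : bilinear_op op) (opeven : even_op G op)
  (op_alpha : {morph alpha : x y / op x y}).

Local Notation D := (dualLstar G alpha op).

Lemma dualL_bilinear : bilinear_for *:%R *:%R (dualL G op).
Proof.
have bil v : bilinear_for *:%R *:%R (fun x (xi : dual) => xi (op x v)).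
  split=> [xi a x x'|x a xi xi'] /=.
    by rewrite !(bilinear_opE opbil) linearP.
  by rewrite add_lfunE scale_lfunE.
have kE v := bilinear_opE (koszul_bilinear G (dual_grading G) (bil v)).
have lin x xi : linear (fun v =>
    - koszul G (dual_grading G) (fun x (xi : dual) => xi (op x v)) x xi).
  move=> a u v; rewrite /koszul scalerN -opprD scaler_sumr -big_split.
  congr (- _); apply: eq_bigr => i _; rewrite /= scaler_sumr -big_split.
  apply: eq_bigr => j _.
  by rewrite /= !(bilinear_opE opbil) linearP scalerDr !scalerA mulrC.
have LE x xi v : dualL G op x xi v =
    - koszul G (dual_grading G) (fun x (xi : dual) => xi (op x v)) x xi.
  rewrite /dualL; pose F := HB.pack (fun v =>
    - koszul G (dual_grading G) (fun x (xi : dual) => xi (op x v)) x xi)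
    (GRing.isLinear.Build _ _ _ _ _ (lin x xi)) : {linear V -> K^o}.
  by rewrite -[linfun _]/(linfun F) lfunE.
split=> [xi a x x'|x a xi xi'] /=; apply/lfunP=> v;
  by rewrite add_lfunE scale_lfunE !LE !kE opprD scalerN.
Qed.

Lemma dualLstar_bilinear : bilinear_for *:%R *:%R D.
Proof.
have LE := bilinear_opE dualL_bilinear.
split=> [xi a x x'|x a xi xi'] /=; rewrite /dualLstar.
  by rewrite linearP !LE.
by rewrite comp_lfunDl -comp_lfunZl !LE.
Qed.

Section Homogeneous.
Variables (p q s : bool) (x y : V) (xi : dual).
Hypotheses (xp : x \in G p) (yq : y \in G q) (xis : xi \in dual_grading G s).

Lemma dualLstar_hom w :
  D (alpha x) xi (alpha (alpha w)) = - (ksgn p s * xi (op x w)).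
Proof.
rewrite /dualLstar (dualL_hom (q := s) _ gG opbil (ae (ae xp))); last first.
  apply: dual_comp_even xis => r v vr.
  by rewrite comp_lfunE !(even_inv ai ae).
by rewrite -!op_alpha !comp_lfunE !lker0_lfunK.
Qed.

Lemma dualLstar_even : D x xi \in dual_grading G (p (+) s).
Proof.
apply/memv_dual_grading => v vG.
have inv := even_inv ai ae.
have xp' := inv _ _ xp; have vG' := inv _ _ (inv _ _ vG).
rewrite -(lker0_lfunVK ai x) -(lker0_lfunVK ai v).
rewrite -(lker0_lfunVK ai ((alpha^-1)%VF v)).
rewrite /dualLstar (dualL_hom (q := s) _ gG opbil (ae (ae xp'))); last first.
  by apply: dual_comp_even xis => r u ur; rewrite comp_lfunE !inv.
rewrite -!op_alpha !comp_lfunE !lker0_lfunK //.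
rewrite (dual_grading_eq0 xis (opeven xp' vG')) ?mulr0 ?oppr0 //.
by case: (p) (s) => [] [].
Qed.

(** The inverse of alpha composed with [xi] is the twisting map of the dual space; it absorbs the
    one alpha left over after the action has consumed alpha on the left factor and alpha^2 on the
    argument. *)
Lemma dualLstar_op (m : V -> V -> V) w : even_op G m ->
  {morph alpha : u v / m u v} ->
  D (m (alpha (alpha x)) (alpha (alpha y))) (xi \o alpha^-1)%VF
    (alpha (alpha (alpha (alpha w)))) =
  - (ksgn (p (+) q) s * xi (op (m x y) (alpha w))).
Proof.
move=> meven m_alpha; rewrite -!m_alpha.
have xiV : (xi \o alpha^-1)%VF \in dual_grading G s.
  by apply: dual_comp_even xis; apply: even_inv.
have mxy := ae (ae (ae (meven _ _ _ _ xp yq))).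
rewrite /dualLstar (dualL_hom (q := s) _ gG opbil mxy); last first.
  by apply: dual_comp_even xiV => r u ur; rewrite comp_lfunE !(even_inv ai ae).
by rewrite -!op_alpha !comp_lfunE !lker0_lfunK.
Qed.

End Homogeneous.

End Operation.

(** Each action consumes one alpha on its vector and two on the argument. Two nested actions thus
    need alpha^4 on [w], and the outer vector needs one more alpha than the inner one. The order is
    again reversed. *)
Lemma dualLstar_comp (op1 op2 : V -> V -> V) p q s x y (xi : dual) w :
  bilinear_op op1 -> {morph alpha : u v / op1 u v} ->
  bilinear_op op2 -> even_op G op2 -> {morph alpha : u v / op2 u v} ->
  x \in G p -> y \in G q -> xi \in dual_grading G s ->
  dualLstar G alpha op1 (alpha (alpha (alpha x)))
    (dualLstar G alpha op2 (alpha (alpha y)) xi) (alpha (alpha (alpha (alpha w)))) =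
  ksgn p (q (+) s) * (ksgn q s * xi (op2 (alpha y) (op1 x w))).
Proof.
move=> bil1 morph1 bil2 even2 morph2 xp yq xis.
have h := dualLstar_even bil2 even2 morph2 (ae (ae yq)) xis.
rewrite (dualLstar_hom bil1 morph1 (ae (ae xp)) h) -!morph1.
by rewrite (dualLstar_hom bil2 morph2 (ae yq) xis) mulrN opprK.
Qed.

End DualAction.

(** * From an anti-pre-Poisson structure to the semidirect product *)

Section AntiPrePoissonToDouble.
Variables (K : fieldType) (V : vectType K) (G : bool -> {vspace V}).
Variables (alpha : 'End(V)) (circ star br mu : V -> V -> V).
Hypotheses (app : hom_anti_pre_Poisson G circ star alpha)
  (brbil : bilinear_op br) (mubil : bilinear_op mu)
  (compat : compatible G circ star br mu).

Let gG : super_grading G. Proof. by case: app => [[[]]]. Qed.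
Let ae : even_map G alpha. Proof. by case: app => [[[]]]. Qed.
Let circbil : bilinear_op circ. Proof. by case: app => [[[]]]. Qed.
Let circeven : even_op G circ. Proof. by case: app => [[[]]]. Qed.
Let starbil : bilinear_op star. Proof. by case: app => [_ [[]]]. Qed.
Let stareven : even_op G star. Proof. by case: app => [_ [[]]]. Qed.

Let oE := (bilinear_opE circbil, bilinear_opE starbil,
  bilinear_opE brbil, bilinear_opE mubil).

Let brE p q x y : x \in G p -> y \in G q -> br x y = circ x y - ksgn p q *: circ y x.
Proof. by move=> xp yq; rewrite -(compat xp yq).1. Qed.
Let muE p q x y : x \in G p -> y \in G q -> mu x y = star x y + ksgn p q *: star y x.
Proof. by move=> xp yq; rewrite -(compat xp yq).2. Qed.

Let breven : even_op G br.
Proof.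
move=> p q x y xp yq; rewrite (brE xp yq); apply: rpredB; first exact: circeven.
by apply: rpredZ; rewrite addbC; apply: circeven.
Qed.

Let mueven : even_op G mu.
Proof.
move=> p q x y xp yq; rewrite (muE xp yq); apply: rpredD; first exact: stareven.
by apply: rpredZ; rewrite addbC; apply: stareven.
Qed.

Let brC p q x y : x \in G p -> y \in G q -> br x y = - (ksgn p q *: br y x).
Proof.
move=> xp yq; apply: eq_by_scalars => f /scalarE fE.
by rewrite (brE xp yq) (brE yq xp) !fE; parity_ring.
Qed.

Let muC p q x y : x \in G p -> y \in G q -> mu x y = ksgn p q *: mu y x.
Proof.
move=> xp yq; apply: eq_by_scalars => f /scalarE fE.
by rewrite (muE xp yq) (muE yq xp) !fE; parity_ring.
Qed.

Lemma alpha_sub_adjacent : {morph alpha : x y / circ x y} ->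
  {morph alpha : x y / star x y} ->
  {morph alpha : x y / br x y} /\ {morph alpha : x y / mu x y}.
Proof.
move=> circ_alpha star_alpha; split=> x y; move: x;
  apply: (super_additive_eq gG) => [x x'|x x'|p x xp]; rewrite ?(linearD, oE) //=;
  rewrite ?(linearD, oE) //; move: y;
  apply: (super_additive_eq gG) => [y y'|y y'|q y yq]; rewrite ?(linearD, oE) //=;
  rewrite ?(linearD, oE) //.
  rewrite (brE xp yq) (brE (ae xp) (ae yq)) linearB linearZ /=.
  by rewrite !circ_alpha.
rewrite (muE xp yq) (muE (ae xp) (ae yq)) linearD linearZ /=.
by rewrite !star_alpha.
Qed.

(** * The anti-pre-Poisson axioms read through a linear form *)

Section ThreeElements.
Variables (f : V -> K) (flin : scalar f).
Let fE := scalarE flin.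
Variables (p q r : bool) (a b c : V).
Hypotheses (ap : a \in G p) (bq : b \in G q) (cr : c \in G r).

Lemma circ_anti v : f (circ (br a b) v) = - (ksgn p q * f (circ (br b a) v)).
Proof. by rewrite (brC ap bq) !(oE, fE). Qed.

Lemma star_br_anti v : f (star (br a b) v) = - (ksgn p q * f (star (br b a) v)).
Proof. by rewrite (brC ap bq) !(oE, fE). Qed.

Lemma star_comm v : f (star (mu a b) v) = ksgn p q * f (star (mu b a) v).
Proof. by rewrite (muC ap bq) !(oE, fE). Qed.

Lemma circ_comm : f (circ (alpha a) (circ b c))
  - ksgn p q * f (circ (alpha b) (circ a c)) + f (circ (br a b) (alpha c)) = 0.
Proof.
case: app => [[_ h _] _ _ _ _]; have := congr1 f (h _ _ _ _ _ _ ap bq cr).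
rewrite (compat bq ap).1 !(oE, fE) circ_anti => comb.
by apply: (eq_by_combination comb); parity_ring.
Qed.

Lemma circ_cycle : f (circ (br a b) (alpha c))
  + ksgn p (q (+) r) * f (circ (br b c) (alpha a))
  + ksgn r (p (+) q) * f (circ (br c a) (alpha b)) = 0.
Proof.
case: app => [[_ _ h] _ _ _ _]; have := congr1 f (h _ _ _ _ _ _ ap bq cr).
by rewrite (compat ap bq).1 (compat bq cr).1 (compat cr ap).1 -(scale0r 0) !fE mul0r.
Qed.

Lemma star_assoc :
  f (star (alpha a) (star b c)) + f (star (mu a b) (alpha c)) = 0.
Proof.
case: app => [_ [_ h _] _ _ _]; have := congr1 f (h _ _ _ _ _ _ ap bq cr).
by rewrite (compat ap bq).2 !fE => ->; rewrite addNr.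
Qed.

Lemma star_cycle : f (star (alpha a) (star b c)) =
  ksgn p (q (+) r) * f (star (alpha b) (star c a)).
Proof.
case: app => [_ [_ _ h] _ _ _]; have := congr1 f (h _ _ _ _ _ _ ap bq cr).
by rewrite !fE.
Qed.

Lemma star_br : f (star (br a b) (alpha c)) =
  ksgn p q * f (star (alpha b) (circ a c)) - f (circ (alpha a) (star b c)).
Proof.
case: app => [_ _ h _ _]; have := congr1 f (h _ _ _ _ _ _ ap bq cr).
by rewrite (compat ap bq).1 !fE.
Qed.

Lemma circ_mu : f (circ (mu a b) (alpha c)) =
  - f (star (alpha a) (circ b c)) - ksgn p q * f (star (alpha b) (circ a c)).
Proof.
case: app => [_ _ _ h _]; have := congr1 f (h _ _ _ _ _ _ ap bq cr).
by rewrite (compat ap bq).2 !fE.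
Qed.

Lemma star_circ_sum : ksgn q r * f (star (alpha a) (circ c b))
  + ksgn p (q (+) r) * f (star (alpha b) (circ c a)) =
  ksgn r (p (+) q) * (f (circ (alpha c) (star a b))
    + ksgn p q * f (circ (alpha c) (star b a)))
  - f (circ (mu a b) (alpha c)).
Proof.
case: app => [_ _ _ _ h]; have := congr1 f (h _ _ _ _ _ _ ap bq cr).
by rewrite (compat ap bq).2 !(fE, oE) (muE ap bq) !(oE, fE).
Qed.

End ThreeElements.

Section ThreeIdentities.
Variables (f : V -> K) (flin : scalar f).
Let fE := scalarE flin.
Variables (p q r : bool) (x y z : V).
Hypotheses (xp : x \in G p) (yq : y \in G q) (zr : z \in G r).

(** By [star_assoc] both sides are minus a product with [mu x y] or [mu y x] on the left, and [mu]
    is supercommutative. *)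
Lemma star_swap : f (star (alpha x) (star y z)) =
  ksgn p q * f (star (alpha y) (star x z)).
Proof.
have comb := (eq_add (eq_scale (- ksgn q p) (star_assoc flin yq xp zr))
  (eq_add (eq_scale (-1) (star_comm flin xp yq (alpha z)))
  (eq_scale 1 (star_assoc flin xp yq zr)))).
apply: (eq_by_combination comb).
by parity_ring.
Qed.

(** Adding axiom (1) for (x, y) to its signed copy for (y, x) kills the bracket terms and exchanges
    [star] of [circ] for [circ] of [star]; axiom (2) then gives the claim. It supplies the [xi] part
    of the Leibniz rule on the semidirect product. *)
Lemma circ_mu_star : f (circ (mu x y) (alpha z)) + f (circ (alpha x) (star y z))
  + ksgn p q * f (circ (alpha y) (star x z)) = 0.
Proof.
have comb := (eq_add (eq_scale (-1) (star_br_anti flin xp yq (alpha z)))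
  (eq_add (eq_scale 1 (star_br flin xp yq zr))
  (eq_add (eq_scale (ksgn q p) (star_br flin yq xp zr))
  (eq_scale 1 (circ_mu flin xp yq zr))))).
apply: (eq_by_combination comb).
by parity_ring.
Qed.

(** In the cyclic sum of the brackets, regrouping the nested terms by [circ_comm] produces a second
    copy of the cyclic sum in [circ_cycle]; hence the factor 2. *)
Lemma sub_adjacent_jacobi : f (br (alpha x) (br y z)) =
  f (br (br x y) (alpha z)) + ksgn p q * f (br (alpha y) (br x z)).
Proof.
rewrite (brE (ae xp) (breven yq zr)) (brE (breven xp yq) (ae zr)).
rewrite (brE (ae yq) (breven xp zr)) !fE.
rewrite [X in circ (alpha x) X](brE yq zr) [X in circ (alpha y) X](brE xp zr).
rewrite [X in circ (alpha z) X](brE xp yq) !(oE, fE).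
have comb := (eq_add (eq_scale (- (2 * ksgn q p * ksgn r p))
    (circ_cycle flin yq zr xp))
  (eq_add (eq_scale 1 (circ_comm flin xp yq zr))
  (eq_add (eq_scale (ksgn r p * ksgn r q) (circ_anti flin zr xp (alpha y)))
  (eq_add (eq_scale (ksgn q p * ksgn r p) (circ_comm flin yq zr xp))
  (eq_scale (ksgn r p * ksgn r q) (circ_comm flin zr xp yq)))))).
apply: (eq_by_combination comb).
by parity_ring.
Qed.

(** After [star_assoc] only triple [star] products remain, and [star_cycle] identifies cyclic
    rotations of x, y, z. Up to sign both sides then reduce to the value on alpha(z), y, x. *)
Lemma sub_adjacent_assoc : f (mu (mu x y) (alpha z)) = f (mu (alpha x) (mu y z)).
Proof.
rewrite (muE (ae xp) (mueven yq zr)) (muE (mueven xp yq) (ae zr)) !fE.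
rewrite [X in star (alpha x) X](muE yq zr).
rewrite [X in star (alpha z) X](muE xp yq) !(oE, fE).
have comb := (eq_add (eq_scale (ksgn q p * ksgn r p) (star_cycle flin yq zr xp))
  (eq_add (eq_scale 1 (star_assoc flin xp yq zr))
  (eq_add (eq_scale (2 * ksgn r p * ksgn r q) (star_cycle flin zr xp yq))
  (eq_add (eq_scale (- (ksgn q p * ksgn r p)) (star_assoc flin yq zr xp))
  (eq_scale (- ksgn r q) (star_cycle flin xp zr yq)))))).
apply: (eq_by_combination comb).
by parity_ring.
Qed.

(** Signs aside, let L be the left side. Axiom (3) says that L is alpha(y) [star] (x [circ] z) plus
    alpha(z) [star] (x [circ] y); by axioms (1) and (2) the right side is twice that sum minus L,
    hence L again. *)
Lemma sub_adjacent_leibniz : f (br (alpha x) (mu y z)) =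
  f (mu (br x y) (alpha z)) + ksgn p q * f (mu (alpha y) (br x z)).
Proof.
rewrite (brE (ae xp) (mueven yq zr)) (muE (breven xp yq) (ae zr)).
rewrite (muE (ae yq) (breven xp zr)) !fE.
rewrite [X in circ (alpha x) X](muE yq zr) [X in star (alpha y) X](brE xp zr).
rewrite [X in star (alpha z) X](brE xp yq) !(oE, fE).
have comb := (eq_add (eq_scale (- (2 * ksgn q p * ksgn r p))
    (star_circ_sum flin yq zr xp))
  (eq_add (eq_scale (-1) (star_br flin xp yq zr))
  (eq_add (eq_scale (ksgn q p * ksgn r p) (circ_mu flin yq zr xp))
  (eq_scale (- ksgn r q) (star_br flin xp zr yq))))).
apply: (eq_by_combination comb).
by parity_ring.
Qed.

End ThreeIdentities.

Hypotheses (ai : lker alpha == 0%VS)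
  (circ_alpha : {morph alpha : x y / circ x y})
  (star_alpha : {morph alpha : x y / star x y}).

(** * The semidirect product and its natural form *)

Local Notation dual := 'Hom(V, K^o).
Local Notation Dc := (dualLstar G alpha circ).
Local Notation Ds := (dualLstar G alpha star).
Local Notation GG := (dsum_grading G).
Local Notation brD := (dsum_bracket G alpha circ br).
Local Notation muD := (dsum_product G alpha star mu).
Local Notation alphaD := (dsum_alpha alpha).
Local Notation form := (dsum_form G).

Let br_alpha := (alpha_sub_adjacent circ_alpha star_alpha).1.
Let mu_alpha := (alpha_sub_adjacent circ_alpha star_alpha).2.
Let Dcbil := dualLstar_bilinear G alpha circbil.
Let Dsbil := dualLstar_bilinear G alpha starbil.
Let DE := (bilinear_opE Dcbil, bilinear_opE Dsbil).
Let Dceven p s x (xi : dual) : x \in G p -> xi \in dual_grading G s ->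
  Dc x xi \in dual_grading G (p (+) s).
Proof. by move=> xp; apply: (dualLstar_even gG ai ae circbil circeven circ_alpha). Qed.
Let Dseven p s x (xi : dual) : x \in G p -> xi \in dual_grading G s ->
  Ds x xi \in dual_grading G (p (+) s).
Proof. by move=> xp; apply: (dualLstar_even gG ai ae starbil stareven star_alpha). Qed.

Let swap_bilinear (f : V -> dual -> dual) : bilinear_for *:%R *:%R f ->
  bilinear_for *:%R *:%R (fun xi x => f x xi).
Proof. by case. Qed.

Lemma dsum_alphaE u : alphaD u = (alpha u.1, (u.2 \o alpha^-1)%VF).
Proof.
have lin : linear (fun u : V * dual => (alpha u.1, (u.2 \o alpha^-1)%VF)).
  by move=> a v w /=; rewrite linearP comp_lfunDl -comp_lfunZl.
rewrite /dsum_alpha; pose F := HB.pack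
  (fun u : V * dual => (alpha u.1, (u.2 \o alpha^-1)%VF))
  (GRing.isLinear.Build _ _ _ _ _ lin) : {linear (V * dual)%type -> (V * dual)%type}.
by rewrite -[linfun _]/(linfun F) lfunE.
Qed.

Lemma dsum_bracketE p q x xi y eta : xi \in dual_grading G p -> y \in G q ->
  brD (x, xi) (y, eta) = (br x y, - Dc x eta + ksgn p q *: Dc y xi).
Proof.
move=> xip yq; rewrite /dsum_bracket /=.
by rewrite (koszul_hom (super_grading_dual gG) gG (swap_bilinear Dcbil) xip yq).
Qed.

Lemma dsum_productE p q x xi y eta : xi \in dual_grading G p -> y \in G q ->
  muD (x, xi) (y, eta) = (mu x y, Ds x eta + ksgn p q *: Ds y xi).
Proof.
move=> xip yq; rewrite /dsum_product /=.
by rewrite (koszul_hom (super_grading_dual gG) gG (swap_bilinear Dsbil) xip yq).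
Qed.

Lemma dsum_homP p x xi :
  reflect (x \in G p /\ xi \in dual_grading G p) ((x, xi) \in GG p).
Proof. by rewrite memv_dsum_grading; apply: andP. Qed.

Lemma dsum_super_grading : super_grading GG.
Proof.
split.
  apply/eqP; rewrite eqEsubv subvf; apply/subvP=> -[x xi] _.
  have [a [b [aG bG ->]]] := super_decomp gG x.
  have [c [d [cG dG ->]]] := super_decomp (super_grading_dual gG) xi.
  have -> : (a + b, c + d) = (a, c) + (b, d) by [].
  by apply: memv_add; rewrite memv_dsum_grading /= ?aG ?bG.
apply/eqP; rewrite -subv0; apply/subvP=> -[x xi].
rewrite memv_cap !memv_dsum_grading /= => /andP[/andP[x0 xi0] /andP[x1 xi1]].
have: x \in (G false :&: G true)%VS by rewrite memv_cap x0.
have: xi \in (dual_grading G false :&: dual_grading G true)%VS.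
  by rewrite memv_cap xi0.
rewrite gG.2 (super_grading_dual gG).2 !memv0 => /eqP -> /eqP ->.
exact: eqxx.
Qed.

Lemma dsum_alpha_even : even_map GG alphaD.
Proof.
move=> p [x xi]; rewrite dsum_alphaE !memv_dsum_grading /= => /andP[xp xip].
by rewrite ae //= dual_comp_even //; apply: even_inv.
Qed.

Lemma dsum_bracket_bilinear : bilinear_op brD.
Proof.
have kE := bilinear_opE (koszul_bilinear (dual_grading G) G (swap_bilinear Dcbil)).
split=> [w a u v|u a v w] /=; apply: injective_projections;
  rewrite /dsum_bracket /= !(oE, DE, kE) // opprD scalerDr scalerN; exact: addrACA.
Qed.

Lemma dsum_product_bilinear : bilinear_op muD.
Proof.
have kE := bilinear_opE (koszul_bilinear (dual_grading G) G (swap_bilinear Dsbil)).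
split=> [w a u v|u a v w] /=; apply: injective_projections;
  rewrite /dsum_product /= !(oE, DE, kE) // scalerDr; exact: addrACA.
Qed.

Lemma dsum_bracket_even : even_op GG brD.
Proof.
move=> p q [x xi] [y eta] /dsum_homP[xp xip] /dsum_homP[yq etaq].
rewrite memv_dsum_grading (dsum_bracketE _ _ xip yq) /= breven //=; apply: rpredD.
  by rewrite rpredN; apply: Dceven.
by apply: rpredZ; rewrite addbC; apply: Dceven.
Qed.

Lemma dsum_product_even : even_op GG muD.
Proof.
move=> p q [x xi] [y eta] /dsum_homP[xp xip] /dsum_homP[yq etaq].
rewrite memv_dsum_grading (dsum_productE _ _ xip yq) /= mueven //=; apply: rpredD.
  exact: Dseven.
by apply: rpredZ; rewrite addbC; apply: Dseven.
Qed.

Lemma dsum_form_bilinear : bilinear_form form.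
Proof.
have bil : bilinear_for *:%R *:%R (fun x (zeta : dual) => zeta x).
  by split=> [xi a x y|x a xi eta] /=; rewrite ?linearP // add_lfunE scale_lfunE.
have kE := bilinear_opE (koszul_bilinear G (dual_grading G) bil).
split=> [w a u v|u a v w] /=; rewrite /dsum_form /= !kE.
  by rewrite add_lfunE scale_lfunE /GRing.scale /=; ring.
by rewrite linearP mulrDr; exact: addrACA.
Qed.

Lemma dsum_formE p q x xi y eta : x \in G p -> eta \in dual_grading G q ->
  form (x, xi) (y, eta) = ksgn p q * eta x + xi y.
Proof.
move=> xp etaq; rewrite /dsum_form /=.
rewrite (koszul_hom gG (super_grading_dual gG) _ xp etaq) //.
by split=> [zeta a u v|u a zeta theta] /=; rewrite ?linearP // add_lfunE scale_lfunE.
Qed.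

Lemma dsum_form_even : even_form GG form.
Proof.
move=> p [x xi] [y eta] /dsum_homP[xp xip] /dsum_homP[yp etap].
rewrite (dsum_formE _ _ xp etap).
rewrite (dual_grading_eq0 etap xp) ?(dual_grading_eq0 xip yp) ?mulr0 ?addr0 //.
  by case: (p).
by case: (p).
Qed.

Lemma dsum_form_supersymmetric : supersymmetric GG form.
Proof.
move=> p q [x xi] [y eta] /dsum_homP[xp xip] /dsum_homP[yq etaq].
rewrite (dsum_formE _ _ xp etaq) (dsum_formE _ _ yq xip).
by parity_ring.
Qed.

Lemma dsum_form_nondegenerate : nondegenerate_form form.
Proof.
have sym u := form_radical_sym u dsum_super_grading dsum_form_bilinear
  dsum_form_even dsum_form_supersymmetric.
have FE := bilinear_formE dsum_form_bilinear.
(* Having both radicals allows each component to be read on the side where the signed term of the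
   form vanishes: [x] by pairing (0, h) on the left of [u], and [xi] by pairing (y, 0) on its
   right. *)
suff rad u : (forall v, form u v = 0) -> (forall v, form v u = 0) -> u = 0.
  by split=> u hu; apply: rad => //; apply/sym.
case: u => x xi hl hr; congr (_, _).
  apply: eq_by_scalars => f flin.
  have lin : linear (f : V -> K^o) := flin.
  pose F := HB.pack (f : V -> K^o) (GRing.isLinear.Build _ _ _ _ _ lin)
    : {linear V -> K^o}.
  have [h hE] : exists h : dual, forall v, h v = f v.
    by exists (linfun F) => v; rewrite lfunE.
  have := hr (0, h); rewrite /dsum_form /=.
  have -> : koszul G (dual_grading G) (fun y (zeta : dual) => zeta y) 0 xi = 0.
    rewrite /koszul big1 // => i _; rewrite big1 // => j _.
    by rewrite !linear0.
  by rewrite add0r hE => ->; rewrite -(scale0r 0) (scalarE flin) mul0r.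
apply/lfunP=> y; rewrite lfunE /=; have := hl (y, 0); rewrite /dsum_form /=.
have -> : koszul G (dual_grading G) (fun y (zeta : dual) => zeta y) x 0 = 0.
  rewrite /koszul big1 // => i _; rewrite big1 // => j _.
  by rewrite linear0 lfunE /= scaler0.
by rewrite add0r.
Qed.

Let Dcc p q s x y (xi : dual) w :
  x \in G p -> y \in G q -> xi \in dual_grading G s ->
  Dc (alpha (alpha (alpha x))) (Dc (alpha (alpha y)) xi)
    (alpha (alpha (alpha (alpha w)))) =
  ksgn p (q (+) s) * (ksgn q s * xi (circ (alpha y) (circ x w))).
Proof. exact: dualLstar_comp. Qed.

Let Dss p q s x y (xi : dual) w :
  x \in G p -> y \in G q -> xi \in dual_grading G s ->
  Ds (alpha (alpha (alpha x))) (Ds (alpha (alpha y)) xi)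
    (alpha (alpha (alpha (alpha w)))) =
  ksgn p (q (+) s) * (ksgn q s * xi (star (alpha y) (star x w))).
Proof. exact: dualLstar_comp. Qed.

Let Dcs p q s x y (xi : dual) w :
  x \in G p -> y \in G q -> xi \in dual_grading G s ->
  Dc (alpha (alpha (alpha x))) (Ds (alpha (alpha y)) xi)
    (alpha (alpha (alpha (alpha w)))) =
  ksgn p (q (+) s) * (ksgn q s * xi (star (alpha y) (circ x w))).
Proof. exact: dualLstar_comp. Qed.

Let Dsc p q s x y (xi : dual) w :
  x \in G p -> y \in G q -> xi \in dual_grading G s ->
  Ds (alpha (alpha (alpha x))) (Dc (alpha (alpha y)) xi)
    (alpha (alpha (alpha (alpha w)))) =
  ksgn p (q (+) s) * (ksgn q s * xi (circ (alpha y) (star x w))).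
Proof. exact: dualLstar_comp. Qed.

Let Dc_br p q s x y (xi : dual) w :
  x \in G p -> y \in G q -> xi \in dual_grading G s ->
  Dc (br (alpha (alpha x)) (alpha (alpha y))) (xi \o alpha^-1)%VF
    (alpha (alpha (alpha (alpha w)))) =
  - (ksgn (p (+) q) s * xi (circ (br x y) (alpha w))).
Proof. by move=> xp yq xis; apply: dualLstar_op. Qed.

Let Dc_mu p q s x y (xi : dual) w :
  x \in G p -> y \in G q -> xi \in dual_grading G s ->
  Dc (mu (alpha (alpha x)) (alpha (alpha y))) (xi \o alpha^-1)%VF
    (alpha (alpha (alpha (alpha w)))) =
  - (ksgn (p (+) q) s * xi (circ (mu x y) (alpha w))).
Proof. by move=> xp yq xis; apply: dualLstar_op. Qed.

Let Ds_br p q s x y (xi : dual) w :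
  x \in G p -> y \in G q -> xi \in dual_grading G s ->
  Ds (br (alpha (alpha x)) (alpha (alpha y))) (xi \o alpha^-1)%VF
    (alpha (alpha (alpha (alpha w)))) =
  - (ksgn (p (+) q) s * xi (star (br x y) (alpha w))).
Proof. by move=> xp yq xis; apply: dualLstar_op. Qed.

Let Ds_mu p q s x y (xi : dual) w :
  x \in G p -> y \in G q -> xi \in dual_grading G s ->
  Ds (mu (alpha (alpha x)) (alpha (alpha y))) (xi \o alpha^-1)%VF
    (alpha (alpha (alpha (alpha w)))) =
  - (ksgn (p (+) q) s * xi (star (mu x y) (alpha w))).
Proof. by move=> xp yq xis; apply: dualLstar_op. Qed.

Let dualE := (fun xi eta : dual => add_lfunE xi eta,
  fun xi : dual => opp_lfunE xi,
  fun a (xi : dual) v => scale_lfunE a xi v : (a *: xi) v = a * xi v).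

Let dual_scalar (xi : dual) : scalar xi.
Proof. by move=> a u v; rewrite linearP. Qed.

Let dsum_bracket_dual a b u v (f g : dual) :
  u \in G a -> v \in G b -> f \in dual_grading G a -> g \in dual_grading G b ->
  - Dc u g + ksgn a b *: Dc v f \in dual_grading G (a (+) b).
Proof.
move=> ua vb fa gb; apply: rpredD; first by rewrite rpredN; apply: Dceven.
by apply: rpredZ; rewrite addbC; apply: Dceven.
Qed.

Let dsum_product_dual a b u v (f g : dual) :
  u \in G a -> v \in G b -> f \in dual_grading G a -> g \in dual_grading G b ->
  Ds u g + ksgn a b *: Ds v f \in dual_grading G (a (+) b).
Proof.
move=> ua vb fa gb; apply: rpredD; first exact: Dseven.
by apply: rpredZ; rewrite addbC; apply: Dseven.
Qed.

Section ThreeHomogeneous.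
Variables (p q r : bool) (x y z : V) (xi eta zeta : dual).
Hypotheses (xp : x \in G p) (yq : y \in G q) (zr : z \in G r).
Hypotheses (xip : xi \in dual_grading G p) (etaq : eta \in dual_grading G q)
  (zetar : zeta \in dual_grading G r).

Local Notation u := (alpha (alpha x), xi).
Local Notation v := (alpha (alpha y), eta).
Local Notation t := (alpha (alpha z), zeta).

Let xp2 := ae (ae xp).
Let yq2 := ae (ae yq).
Let zr2 := ae (ae zr).
Let xiV := dual_comp_even (even_inv ai ae) xip.
Let etaV := dual_comp_even (even_inv ai ae) etaq.

Let bruv_even := dsum_bracket_dual xp2 yq2 xip etaq.
Let muuv_even := dsum_product_dual xp2 yq2 xip etaq.

(** The dual component splits into parts carrying [zeta], [eta] and [xi]; each is [circ_comm] for
    the two vectors that do not accompany that form. *)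
Lemma dsum_jacobi : brD (alphaD u) (brD v t) =
  brD (brD u v) (alphaD t) + ksgn p q *: brD (alphaD v) (brD u t).
Proof.
rewrite !dsum_alphaE /= (dsum_bracketE _ _ etaq zr2) (dsum_bracketE _ _ xip yq2).
rewrite (dsum_bracketE _ _ xip zr2) (dsum_bracketE _ _ xiV (breven yq2 zr2)).
rewrite (dsum_bracketE _ _ bruv_even (ae zr2)) (dsum_bracketE _ _ etaV (breven xp2 zr2)).
apply: injective_projections => /=.
  apply: eq_by_scalars => f flin.
  by rewrite !(scalarE flin) (sub_adjacent_jacobi flin xp2 yq2 zr2).
apply: (dual_hom_eq gG ai ae) => s w ws; rewrite !(DE, dualE).
rewrite (Dcc _ xp yq zetar) (Dcc _ xp zr etaq) (Dc_br _ yq zr xip).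
rewrite (Dc_br _ xp yq zetar) (Dcc _ zr xp etaq) (Dcc _ zr yq xip).
rewrite (Dcc _ yq xp zetar) (Dcc _ yq zr xip) (Dc_br _ xp zr etaq).
have comb :=
  (eq_add (eq_scale (- ksgn (p (+) q) r)
    (circ_comm (dual_scalar zeta) xp yq ws))
  (eq_add (eq_scale (ksgn p q) (circ_comm (dual_scalar eta) xp zr ws))
    (eq_scale (-1) (circ_comm (dual_scalar xi) yq zr ws)))).
apply: (eq_by_combination comb).
by parity_ring.
Qed.

(** In the dual component the [xi] part is [star_assoc], the [eta] part is [star_swap], and the
    [zeta] part needs both because the order of the two actions is reversed. *)
Lemma dsum_assoc : muD (muD u v) (alphaD t) = muD (alphaD u) (muD v t).
Proof.
rewrite !dsum_alphaE /= (dsum_productE _ _ etaq zr2) (dsum_productE _ _ xip yq2).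
rewrite (dsum_productE _ _ xiV (mueven yq2 zr2)).
rewrite (dsum_productE _ _ muuv_even (ae zr2)).
apply: injective_projections => /=.
  apply: eq_by_scalars => f flin.
  exact: (sub_adjacent_assoc flin xp2 yq2 zr2).
apply: (dual_hom_eq gG ai ae) => s w ws; rewrite !(DE, dualE).
rewrite (Ds_mu _ xp yq zetar) (Dss _ zr xp etaq) (Dss _ zr yq xip).
rewrite (Dss _ xp yq zetar) (Dss _ xp zr etaq) (Ds_mu _ yq zr xip).
have comb :=
  (eq_add (eq_scale (- ksgn (p (+) q) r)
    (star_assoc (dual_scalar zeta) xp yq ws))
  (eq_add (eq_scale (ksgn (p (+) q) r) (star_swap (dual_scalar zeta) xp yq ws))
  (eq_add (eq_scale (ksgn p q) (star_swap (dual_scalar eta) xp zr ws))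
    (eq_scale 1 (star_assoc (dual_scalar xi) yq zr ws))))).
apply: (eq_by_combination comb).
by parity_ring.
Qed.

(** In the dual component [zeta] and [eta] each receive axiom (1), whereas [xi], on which the
    product acts through [circ], receives [circ_mu_star]. *)
Lemma dsum_leibniz : brD (alphaD u) (muD v t) =
  muD (brD u v) (alphaD t) + ksgn p q *: muD (alphaD v) (brD u t).
Proof.
rewrite !dsum_alphaE /= (dsum_productE _ _ etaq zr2) (dsum_bracketE _ _ xip yq2).
rewrite (dsum_bracketE _ _ xip zr2) (dsum_bracketE _ _ xiV (mueven yq2 zr2)).
rewrite (dsum_productE _ _ bruv_even (ae zr2)) (dsum_productE _ _ etaV (breven xp2 zr2)).
apply: injective_projections => /=.
  apply: eq_by_scalars => f flin.
  by rewrite !(scalarE flin) (sub_adjacent_leibniz flin xp2 yq2 zr2).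
apply: (dual_hom_eq gG ai ae) => s w ws; rewrite !(DE, dualE).
rewrite (Dcs _ xp yq zetar) (Dcs _ xp zr etaq) (Dc_mu _ yq zr xip).
rewrite (Ds_br _ xp yq zetar) (Dsc _ zr xp etaq) (Dsc _ zr yq xip).
rewrite (Dsc _ yq xp zetar) (Dsc _ yq zr xip) (Ds_br _ xp zr etaq).
have comb :=
  (eq_add (eq_scale (ksgn (p (+) q) r) (star_br (dual_scalar zeta) xp yq ws))
  (eq_add (eq_scale (ksgn p q) (star_br (dual_scalar eta) xp zr ws))
    (eq_scale (-1) (circ_mu_star (dual_scalar xi) yq zr ws)))).
apply: (eq_by_combination comb).
by parity_ring.
Qed.

End ThreeHomogeneous.

Lemma dsum_hom_inv p u : u \in GG p -> exists x xi,
  [/\ u = (alpha (alpha x), xi), x \in G p & xi \in dual_grading G p].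
Proof.
case: u => x xi /dsum_homP[xp xip].
exists ((alpha^-1)%VF ((alpha^-1)%VF x)), xi.
by split; rewrite ?(lker0_lfunVK ai) //; do 2!apply: (even_inv ai ae).
Qed.

Lemma dsum_Poisson : hom_Poisson GG brD muD alphaD.
Proof.
split; [split|split|].
- split; [exact: dsum_super_grading|exact: dsum_bracket_bilinear|
    exact: dsum_bracket_even|exact: dsum_alpha_even].
- move=> p q [x xi] [y eta] /dsum_homP[xp xip] /dsum_homP[yq etaq].
  rewrite (dsum_bracketE _ _ xip yq) (dsum_bracketE _ _ etaq xp).
  apply: injective_projections => /=; first exact: brC.
  apply/lfunP=> v; rewrite !(DE, dualE).
  by parity_ring.
- move=> p q r u v t /dsum_hom_inv[x [xi [-> xp xip]]].
  case/dsum_hom_inv=> y [eta [-> yq etaq]]; case/dsum_hom_inv=> z [zeta [-> zr zetar]].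
  exact: (dsum_jacobi xp yq zr xip etaq zetar).
- split; [exact: dsum_super_grading|exact: dsum_product_bilinear|
    exact: dsum_product_even|exact: dsum_alpha_even].
- move=> p q [x xi] [y eta] /dsum_homP[xp xip] /dsum_homP[yq etaq].
  rewrite (dsum_productE _ _ xip yq) (dsum_productE _ _ etaq xp).
  apply: injective_projections => /=; first exact: muC.
  apply/lfunP=> v; rewrite !(DE, dualE).
  by parity_ring.
- move=> p q r u v t /dsum_hom_inv[x [xi [-> xp xip]]].
  case/dsum_hom_inv=> y [eta [-> yq etaq]]; case/dsum_hom_inv=> z [zeta [-> zr zetar]].
  exact: (dsum_assoc xp yq zr xip etaq zetar).
move=> p q r u v t /dsum_hom_inv[x [xi [-> xp xip]]].
case/dsum_hom_inv=> y [eta [-> yq etaq]]; case/dsum_hom_inv=> z [zeta [-> zr zetar]].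
exact: (dsum_leibniz xp yq zr xip etaq zetar).
Qed.

Let Dc_hom p s x (xi : dual) w : x \in G p -> xi \in dual_grading G s ->
  Dc (alpha x) xi (alpha (alpha w)) = - (ksgn p s * xi (circ x w)).
Proof. by move=> xp xis; rewrite (dualLstar_hom gG ai ae circbil circ_alpha xp xis). Qed.

Let Ds_hom p s x (xi : dual) w : x \in G p -> xi \in dual_grading G s ->
  Ds (alpha x) xi (alpha (alpha w)) = - (ksgn p s * xi (star x w)).
Proof. by move=> xp xis; rewrite (dualLstar_hom gG ai ae starbil star_alpha xp xis). Qed.

(** Each of [xi], [eta], [zeta] is applied once to a bracket and once to each of the two [circ]
    products composing it, with cancelling signs. The Connes condition arises likewise from [mu] and
    [star]. *)
Lemma dsum_two_cocycle : two_cocycle GG brD alphaD form.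
Proof.
split; [exact: dsum_form_bilinear|exact: dsum_form_even|
  exact: dsum_form_supersymmetric|].
move=> p q r u v t /dsum_hom_inv[x' [xi [-> /ae xp xip]]].
case/dsum_hom_inv=> y' [eta [-> /ae yq etaq]].
case/dsum_hom_inv=> z' [zeta [-> /ae zr zetar]].
(* Only one dual action occurs in each term, so a single alpha on the vectors is enough and the
   other is absorbed into the names. *)
move: (alpha x') (alpha y') (alpha z') xp yq zr => x y z xp yq zr.
have [xp1 yq1 zr1] := And3 (ae xp) (ae yq) (ae zr).
rewrite !dsum_alphaE /= (dsum_bracketE _ _ etaq zr1) (dsum_bracketE _ _ zetar xp1).
rewrite (dsum_bracketE _ _ xip yq1).
rewrite (dsum_formE _ _ (ae xp1) (dsum_bracket_dual yq1 zr1 etaq zetar)).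
rewrite (dsum_formE _ _ (ae yq1) (dsum_bracket_dual zr1 xp1 zetar xip)).
rewrite (dsum_formE _ _ (ae zr1) (dsum_bracket_dual xp1 yq1 xip etaq)).
rewrite !comp_lfunE -!br_alpha !lker0_lfunK // !dualE.
rewrite (Dc_hom _ yq zetar) (Dc_hom _ zr etaq) (Dc_hom _ zr xip).
rewrite (Dc_hom _ xp zetar) (Dc_hom _ xp etaq) (Dc_hom _ yq xip).
rewrite (brE yq zr) (brE zr xp) (brE xp yq).
rewrite !(scalarE (dual_scalar xi), scalarE (dual_scalar eta),
  scalarE (dual_scalar zeta)).
by parity_ring.
Qed.

Lemma dsum_Connes_cocycle : Connes_cocycle GG muD alphaD form.
Proof.
split; [exact: dsum_form_bilinear|exact: dsum_form_even|
  exact: dsum_form_supersymmetric|].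
move=> p q r u v t /dsum_hom_inv[x' [xi [-> /ae xp xip]]].
case/dsum_hom_inv=> y' [eta [-> /ae yq etaq]].
case/dsum_hom_inv=> z' [zeta [-> /ae zr zetar]].
move: (alpha x') (alpha y') (alpha z') xp yq zr => x y z xp yq zr.
have [xp1 yq1 zr1] := And3 (ae xp) (ae yq) (ae zr).
rewrite !dsum_alphaE /= (dsum_productE _ _ etaq zr1) (dsum_productE _ _ zetar xp1).
rewrite (dsum_productE _ _ xip yq1).
have inv s (f : dual) := @dual_comp_even _ _ G s f _ (even_inv ai ae).
rewrite (dsum_formE _ _ (mueven xp1 yq1) (inv _ _ zetar)).
rewrite (dsum_formE _ _ (mueven yq1 zr1) (inv _ _ xip)).
rewrite (dsum_formE _ _ (mueven zr1 xp1) (inv _ _ etaq)).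
rewrite !comp_lfunE -!mu_alpha !lker0_lfunK // !dualE.
rewrite (Ds_hom _ yq zetar) (Ds_hom _ zr etaq) (Ds_hom _ zr xip).
rewrite (Ds_hom _ xp zetar) (Ds_hom _ xp etaq) (Ds_hom _ yq xip).
rewrite (muE yq zr) (muE zr xp) (muE xp yq).
rewrite !(scalarE (dual_scalar xi), scalarE (dual_scalar eta),
  scalarE (dual_scalar zeta)).
by parity_ring.
Qed.
End AntiPrePoissonToDouble.

Unset Implicit Arguments.

Theorem proposition4p2 (K : fieldType) (charK : [pchar K] =i pred0)
    (V : vectType K) (G : bool -> {vspace V}) (alpha : 'End(V)) :
  (forall (br mu : V -> V -> V) (B : V -> V -> K),
      hom_Poisson G br mu alpha ->
      {morph alpha : x y / br x y} ->
      {morph alpha : x y / mu x y} ->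
      nondegenerate_form B ->
      two_cocycle G br alpha B ->
      Connes_cocycle G mu alpha B ->
      twist_invariant alpha B ->
      exists circ star : V -> V -> V,
        [/\ hom_anti_pre_Poisson G circ star alpha,
            compatible G circ star br mu,
            forall p q r x y z, x \in G p -> y \in G q -> z \in G r ->
              B (star (alpha x) (alpha y)) (alpha (alpha z)) =
              - (ksgn p q * B (alpha y) (mu x z))
          & forall p q r x y z, x \in G p -> y \in G q -> z \in G r ->
              B (circ (alpha x) (alpha y)) (alpha (alpha z)) =
              ksgn p q * B (alpha y) (br x z)])
  /\
  (forall circ star br mu : V -> V -> V,
      hom_anti_pre_Poisson G circ star alpha ->
      lker alpha == 0%VS ->
      {morph alpha : x y / circ x y} ->
      {morph alpha : x y / star x y} ->
      bilinear_op br -> bilinear_op mu ->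
      compatible G circ star br mu ->
      [/\ hom_Poisson (dsum_grading G) (dsum_bracket G alpha circ br)
            (dsum_product G alpha star mu) (dsum_alpha alpha),
          nondegenerate_form (dsum_form G),
          supersymmetric (dsum_grading G) (dsum_form G),
          two_cocycle (dsum_grading G) (dsum_bracket G alpha circ br)
            (dsum_alpha alpha) (dsum_form G)
        & Connes_cocycle (dsum_grading G) (dsum_product G alpha star mu)
            (dsum_alpha alpha) (dsum_form G)]).
Proof.
have two_neq0 : 2%:R != 0 :> K by have := charK 2%N; rewrite !inE /= => ->.
split=> [br mu B poisson br_alpha mu_alpha Bnd cocB connesB Binv|].
  exact: (cocycles_anti_pre_Poisson two_neq0 poisson).
move=> circ star br mu app ai circ_alpha star_alpha brbil mubil compat.
split.
- exact: (dsum_Poisson app brbil mubil compat ai circ_alpha star_alpha).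
- exact: (dsum_form_nondegenerate app).
- exact: (dsum_form_supersymmetric app).
- exact: (dsum_two_cocycle app brbil mubil compat ai circ_alpha star_alpha).
- exact: (dsum_Connes_cocycle app brbil mubil compat ai circ_alpha star_alpha).
Qed.
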